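(* There is an algorithm that, given a tubular group $G$ with a single vertex group, decides in finite time whether or not $G$ is residually finite. Explicitly: there is an algorithm which, given as input an integer $n\ge 0$ and nonzero vectors $u_1,v_1,\dots,u_n,v_n\in\mathbb{Z}^2$, always halts and correctly decides whether the group $$G=\langle\, \mathbb{Z}^2, s_1,\dots,s_n \mid s_i^{-1}u_i s_i = v_i,\ i=1,\dots,n \,\rangle$$ is residually finite.
   Context: A finitely generated group is tubular if it splits as a finite graph of groups with every vertex group isomorphic to $\mathbb{Z}^2$ and every edge group isomorphic to $\mathbb{Z}$. A tubular group with a single vertex group (underlying graph a single vertex with $n$ loops) is exactly a multiple HNN extension of $\mathbb{Z}^2$ as displayed, where $s_1,\dots,s_n$ are the stable letters, and $u_i,v_i$ are the images in the vertex group $\mathbb{Z}^2$ of a generator of the $i$-th edge group under its two attaching maps. In the presentation, the relations of $\mathbb{Z}^2$ are understood to be included. A group is residually finite if for each nontrivial element there is a finite quotient of the group in which the image of that element is nontrivial. *)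

(* Defs.v *)
From HB Require Import structures.
From mathcomp Require Import all_boot all_order all_algebra all_fingroup.
From mathcomp Require Import generic_quotient boolp.

Set Implicit Arguments.
Unset Strict Implicit.
Unset Printing Implicit Defensive.

Import GRing.Theory.
Local Open Scope quotient_scope.

(* Algorithms: Kleene's partial recursive functions, in k arguments. *)
Inductive recf : nat -> Type :=
| Zero k : recf k
| Succ : recf 1
| Proj k (i : 'I_k) : recf k
| Comp k m (f : recf m) (g : 'I_m -> recf k) : recf k
| Prec k (f : recf k) (g : recf k.+2) : recf k.+1
| Mu k (f : recf k.+1) : recf k.

(* [eval f v y]: the computation of f on input v halts and outputs y.
   Prec recurses on the first argument; Mu searches for the least first
   argument at which f vanishes, f being defined at all the earlier ones. *)
Fixpoint eval k (f : recf k) : k.-tuple nat -> nat -> Prop :=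
  match f in recf k return k.-tuple nat -> nat -> Prop with
  | Zero _ => fun _ y => y = 0
  | Succ => fun v y => y = (thead v).+1
  | Proj _ i => fun v y => y = tnth v i
  | Comp _ m f g => fun v y =>
      exists w : m.-tuple nat,
        (forall i, eval (g i) v (tnth w i)) /\ eval f w y
  | Prec _ f g => fun v =>
      let v' := behead_tuple v in
      (fix rec (a : nat) (y : nat) : Prop :=
         if a is a'.+1 then
           exists z, rec a' z /\ eval g [tuple of [:: a', z & v']] y
         else eval f v' y) (thead v)
  | Mu _ f => fun v y =>
      eval f [tuple of y :: v] 0 /\
      (forall i, i < y -> exists z, eval f [tuple of i :: v] z.+1)
  end.

Lemma eval_functional k (f : recf k) v y z : eval f v y -> eval f v z -> y = z.
Proof.
elim: f v y z => {k}.
- by move=> k v y z /= -> ->.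
- by move=> v y z /= -> ->.
- by move=> k i v y z /= -> ->.
- move=> k m f IHf g IHg v y z /= [w [gw fw]] [w' [gw' fw']].
  suff ww' : w = w' by apply: IHf fw _; rewrite ww'.
  by apply: eq_from_tnth => i; apply: IHg (gw i) (gw' i).
- move=> k f IHf g IHg v /=; elim: (thead v) => [|a IHa] y z; first exact: IHf.
  by move=> [y' [/IHa ry gy]] [z' [/ry <- gz]]; apply: IHg gy gz.
- move=> k f IHf v y z /= [fy ly] [fz lz].
  by case: (ltngtP y z) => // [/lz|/ly] [t] ft;
    [have := IHf _ _ _ fy ft|have := IHf _ _ _ fz ft].
Qed.

(* Group presentations.  The letter (x, false) stands for the generator x, and
   (x, true) for its inverse. *)
Definition word (X : Type) := seq (X * bool).

Section Presentation.
Variables (X : choiceType) (R : word X -> word X -> Prop).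

Inductive pres_eq : word X -> word X -> Prop :=
| pres_refl w : pres_eq w w
| pres_sym w w' : pres_eq w w' -> pres_eq w' w
| pres_trans w w' w'' : pres_eq w w' -> pres_eq w' w'' -> pres_eq w w''
| pres_cat w1 w1' w2 w2' :
    pres_eq w1 w1' -> pres_eq w2 w2' -> pres_eq (w1 ++ w2) (w1' ++ w2')
| pres_cancel x b : pres_eq [:: (x, b); (x, ~~ b)] [::]
| pres_rel l r : R l r -> pres_eq l r.

Definition pres_eqb : rel (word X) := fun w w' => `[< pres_eq w w' >].

Lemma pres_eqb_equiv : equiv_class_of pres_eqb.
Proof.
split=> [w|w w'|w' w w''].
- exact/asboolP/pres_refl.
- by apply/asboolP/asboolP; apply: pres_sym.
- by move=> /asboolP ww' /asboolP w'w''; apply/asboolP/(pres_trans ww').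
Qed.

Canonical pres_equiv := EquivRelPack pres_eqb_equiv.

Definition presented := {eq_quot pres_equiv}.

HB.instance Definition _ := Choice.on presented.
HB.instance Definition _ := EqQuotient.on presented.

Definition word_inv (w : word X) : word X :=
  rev [seq (a.1, ~~ a.2) | a <- w].

Definition pres_of (w : word X) : presented := \pi_presented w.
Definition pres_mul (g h : presented) := pres_of (repr g ++ repr h).
Definition pres_one := pres_of [::].
Definition pres_inv (g : presented) := pres_of (word_inv (repr g)).

Lemma pres_ofP w w' : pres_of w = pres_of w' <-> pres_eq w w'.
Proof. by split=> [/eqquotP/asboolP|?] //; apply/eqquotP/asboolP. Qed.

Lemma repr_pres_of w : pres_eq (repr (pres_of w)) w.
Proof. by apply/pres_ofP; rewrite /pres_of reprK. Qed.

Lemma pres_ofK g : pres_of (repr g) = g.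
Proof. exact: reprK. Qed.

Lemma pres_of_cat w w' : pres_mul (pres_of w) (pres_of w') = pres_of (w ++ w').
Proof. by apply/pres_ofP/pres_cat; apply: repr_pres_of. Qed.

Lemma word_invP w : pres_eq (word_inv w ++ w) [::].
Proof.
elim: w => [|[x b] w IHw]; first exact: pres_refl.
rewrite /word_inv /= rev_cons cat_rcons.
apply: pres_trans IHw; apply: pres_cat; first exact: pres_refl.
rewrite -[X in pres_eq _ X]cat0s -[(x, ~~ b) :: _]/([:: _; _] ++ w).
apply: pres_cat; last exact: pres_refl.
by have := pres_cancel x (~~ b); rewrite negbK.
Qed.

Lemma word_invK : involutive word_inv.
Proof.
move=> w; rewrite /word_inv map_rev revK -map_comp -[RHS]map_id.
by apply: eq_map => -[x b] /=; rewrite negbK.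
Qed.

Lemma pres_mulA : associative pres_mul.
Proof.
move=> f g h.
by rewrite -(pres_ofK f) -(pres_ofK g) -(pres_ofK h) !pres_of_cat catA.
Qed.

Lemma pres_mul1 : left_id pres_one pres_mul.
Proof. by move=> g; rewrite -(pres_ofK g) pres_of_cat. Qed.

Lemma pres_mulr1 : right_id pres_one pres_mul.
Proof. by move=> g; rewrite -(pres_ofK g) pres_of_cat cats0. Qed.

Lemma pres_mulV : left_inverse pres_one pres_inv pres_mul.
Proof.
move=> g; rewrite -{2}(pres_ofK g) pres_of_cat.
exact/pres_ofP/word_invP.
Qed.

Lemma pres_mulrV : right_inverse pres_one pres_inv pres_mul.
Proof.
move=> g; rewrite -{1}(pres_ofK g) pres_of_cat.
by apply/pres_ofP; rewrite -{1}(word_invK (repr g)); apply: word_invP.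
Qed.

HB.instance Definition _ := isGroup.Build presented
  pres_mulA pres_mul1 pres_mulr1 pres_mulV pres_mulrV.

End Presentation.

Definition residually_finite (G : groupType) : Prop :=
  forall g : G, (g != 1)%g ->
  exists (Q : finGroupType) (f : {multiplicative G -> Q}),
    (forall q, exists h, f h = q) /\ (f g != 1)%g.

Section Tubular.
Variables (n : nat) (u v : 'I_n -> 'rV[int]_2).

(* Generators: all the elements of Z^2, and the stable letters. *)
Definition tub_gen : choiceType := ('rV[int]_2 + 'I_n)%type.

Definition vert (x : 'rV[int]_2) : tub_gen * bool := (inl x, false).
Definition stable (i : 'I_n) : tub_gen * bool := (inr i, false).
Definition stableV (i : 'I_n) : tub_gen * bool := (inr i, true).

(* The relations of Z^2 are given by its multiplication table. *)
Inductive tub_rel : word tub_gen -> word tub_gen -> Prop :=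
| tub_Z2 x y : tub_rel [:: vert x; vert y] [:: vert (x + y)%R]
| tub_hnn i : tub_rel [:: stableV i; vert (u i); stable i] [:: vert (v i)].

Definition tubular_group : groupType := presented tub_rel.

Definition int_code (z : int) : nat :=
  match z with Posz m => m.*2 | Negz m => m.*2.+1 end.

Definition vec_code (x : 'rV[int]_2) : seq nat :=
  [:: int_code (x 0 0)%R; int_code (x 0 1)%R].

(* The input to the algorithm: the list n, u_1, v_1, ..., u_n, v_n of integers,
   as a natural number. *)
Definition tubular_code : nat :=
  CodeSeq.code
    (n :: flatten [seq vec_code (u i) ++ vec_code (v i) | i <- enum 'I_n]).

End Tubular.

(* Main.v *)
From HB Require Import structures.
Require Import Defs.
From mathcomp Require Import all_boot all_order all_algebra all_fingroup.
From mathcomp Require Import cyclic zify ring boolp.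

(** The group [G] acts on a tree, and everything is decided by the finite-index
    subgroups [L] of [Z^2] that are traces of kernels of finite quotients of
    [G].  Such an [L] is balanced: each [u i] has the same order as [v i] modulo
    [L].  Three steps reduce residual finiteness to a finite computation.

    First, [G] is residually finite if and only if the edge groups [<u i>] and
    [<v i>] are separable, i.e., are intersections of sets [<u i> + L] with [L]
    balanced.  If [x] lies outside [<u i>] but in all the [<u i> + L], then in
    every finite quotient the conjugate of [x] by [s_i] lies in the image of
    [<v i>] and commutes with all of [Z^2], although in [G] it does not
    ([commutator_neq1], by an explicit action on the rational plane); this is
    [residually_finite_separable].  Conversely, an element of [G] has a reduced
    form; a balanced [L] that keeps it reduced turns it into a path without
    backtracking over finitely many copies of [Z^2 / L], and the partial
    permutations drawn by this path extend to a finite action of [G] that moves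
    the starting point ([path_action], [separable_residually_finite]).

    Second, separability is local: it holds if and only if, for each prime [p],
    there is a lattice in which [u i] and [v i] have contents with the same
    [p]-adic valuation, for all [i] at once ([separable_local]).  From left to
    right, a single balanced subgroup that meets the line of each edge group
    inside that edge group gives a lattice that works for all [p]; from right to
    left, dilate the local lattices and intersect them for small [p].

    Third, at a given [p] finitely many lattices suffice.  For dependent [u i],
    [v i], being balanced does not depend on the lattice.  For independent ones,
    the balanced lattices form a subtree of the tree of homothety classes of
    [p]-adic lattices, and the only edges leaving it are at the lattice spanned
    by [u i] and [v i].  On the way from any common point of these subtrees to
    the class of [Z^2], the last common point is therefore either the class of
    [Z^2] or that of some pair [u j], [v j] ([balanced_finite]).  As [Z^2] itself
    is balanced at the primes exceeding all the contents involved, only bounded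
    searches remain; they are primitive recursive ([decidable_rf_test]). *)

Set Implicit Arguments.
Unset Strict Implicit.
Unset Printing Implicit Defensive.

(** * Primitive recursive functions *)

(** The arguments are read off a sequence, the default value 0 being returned
    beyond its end: variables can then be addressed by plain numbers, and
    binding a new one is just [cons]. *)
Definition computable k (F : seq nat -> nat) : Prop :=
  exists f : recf k, forall v : k.-tuple nat, eval f v (F v).

Lemma computable_ext k (F G : seq nat -> nat) :
  F =1 G -> computable k F -> computable k G.
Proof. by move=> FG [f fP]; exists f => v; rewrite -FG. Qed.

Lemma computable_var k i : computable k (fun v => nth 0 v i).
Proof.
case: (ltnP i k) => [lt_ik | le_ki]; last first.
  by exists (Zero k) => v /=; rewrite nth_default ?size_tuple.
by exists (Proj (Ordinal lt_ik)) => v /=; rewrite (tnth_nth 0).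
Qed.

Lemma computable_comp k (F : seq nat -> nat) (Gs : seq (seq nat -> nat)) :
  computable (size Gs) F ->
  (forall i, i < size Gs -> computable k (nth (fun=> 0) Gs i)) ->
  computable k (fun v => F [seq G v | G <- Gs]).
Proof.
move=> [f fP] Gs_comp.
have /fin_all_exists[g gP] (i : 'I_(size Gs)) := Gs_comp i (ltn_ord i).
exists (Comp f g) => v.
exists (map_tuple (fun G : seq nat -> nat => G v) (in_tuple Gs)).
split=> [i|]; last exact: fP.
by rewrite tnth_map (tnth_nth (fun=> 0)).
Qed.

Lemma computable_const k c : computable k (fun=> c).
Proof.
elim: c => [|c [f fP]]; first by exists (Zero k).
exists (Comp Succ (fun=> f)) => v /=.
by exists [tuple of [:: c]]; split=> // i; rewrite (ord1 i).
Qed.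

Lemma computable_succ k F : computable k F -> computable k (fun v => (F v).+1).
Proof.
move=> F_comp; apply: (@computable_comp k (fun v => (nth 0 v 0).+1) [:: F]).
  by exists Succ => v /=; rewrite /thead (tnth_nth 0).
by case.
Qed.

(** [Prec] recurses on its first argument, with the others as parameters; a
    computed bound is supplied by composition with projections. *)
Lemma computable_iter k B F G :
  computable k B -> computable k F -> computable k.+2 G ->
  computable k (fun v => iteri (B v) (fun a z => G [:: a, z & v]) (F v)).
Proof.
move=> B_comp [f fP] [g gP].
pose H v := iteri (head 0 v) (fun a z => G [:: a, z & behead v]) (F (behead v)).
have H_comp : computable k.+1 H.
  exists (Prec f g) => v /=; rewrite /H.
  have -> : head 0 v = thead v by rewrite -nth0 /thead (tnth_nth 0).
  elim: (thead v) => [|a IHa] /=; first exact: (fP (behead_tuple v)).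
  exists (iteri a (fun a z => G [:: a, z & behead v]) (F (behead v))).
  split=> //; exact: (gP [tuple of [:: a, _ & behead_tuple v]]).
pose Gs := B :: [seq fun v => nth 0 v i | i <- iota 0 k].
have [] // := @computable_comp k H Gs.
- by rewrite /= size_map size_iota.
- move=> [|i]; first by [].
  rewrite /= size_map size_iota ltnS => lt_ik.
  rewrite (nth_map 0) ?size_iota // nth_iota //.
  exact: computable_var.
move=> h hP; exists h => v; have := hP v; rewrite /H /= -map_comp.
suff -> : [seq ((fun G0 => G0 v) \o (fun i v0 => nth 0 v0 i)) i | i <- iota 0 k]
          = v :> seq nat by [].
apply: (@eq_from_nth _ 0); rewrite ?size_map ?size_iota ?size_tuple // => i lt_ik.
by rewrite (nth_map 0) ?size_iota //= nth_iota.
Qed.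

Section Closure.
Variables (k : nat) (A B : seq nat -> nat).
Hypotheses (A_comp : computable k A) (B_comp : computable k B).

Lemma computable_add : computable k (fun v => A v + B v).
Proof.
have := computable_iter B_comp A_comp (computable_succ (computable_var k.+2 1)).
apply: computable_ext => v /=.
by elim: (B v) => [|b IHb] /=; rewrite ?addn0 ?addnS ?IHb.
Qed.

Lemma computable_pred : computable k (fun v => (A v).-1).
Proof.
have := computable_iter A_comp (computable_const k 0) (computable_var k.+2 0).
by apply: computable_ext => v /=; case: (A v).
Qed.

End Closure.

Section Arithmetic.
Variables (k : nat) (A B : seq nat -> nat).
Hypotheses (A_comp : computable k A) (B_comp : computable k B).

(** Allows each operation to be programmed on two variables, where its recursion
    is easy to write, and then applied to arbitrary expressions. *)
Lemma computable_app2 (F : nat -> nat -> nat) :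
  computable 2 (fun v => F (nth 0 v 0) (nth 0 v 1)) ->
  computable k (fun v => F (A v) (B v)).
Proof.
move=> F_comp.
by apply: (@computable_comp k (fun v => F (nth 0 v 0) (nth 0 v 1)) [:: A; B])
  => // -[|[|]].
Qed.

Lemma computable_sub : computable k (fun v => A v - B v).
Proof.
apply: (computable_app2 (F := subn)).
have := computable_iter (computable_var 2 1) (computable_var 2 0)
  (computable_pred (computable_var 4 1)).
apply: computable_ext => v /=.
by elim: (nth 0 v 1) => [|b IHb] /=; rewrite ?subn0 ?subnS ?IHb.
Qed.

Lemma computable_mul : computable k (fun v => A v * B v).
Proof.
apply: (computable_app2 (F := muln)).
have := computable_iter (computable_var 2 1) (computable_const 2 0)
  (computable_add (computable_var 4 1) (computable_var 4 2)).
apply: computable_ext => v /=.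
by elim: (nth 0 v 1) => [|b IHb] /=; rewrite ?muln0 // IHb mulnS addnC.
Qed.

End Arithmetic.

Lemma computable_exp k A B : computable k A -> computable k B ->
  computable k (fun v => A v ^ B v).
Proof.
move=> A_comp B_comp; apply: (computable_app2 A_comp B_comp (F := expn)).
have := computable_iter (computable_var 2 1) (computable_const 2 1)
  (computable_mul (computable_var 4 1) (computable_var 4 2)).
apply: computable_ext => v /=.
by elim: (nth 0 v 1) => [|b IHb] /=; rewrite ?expn0 // IHb expnSr.
Qed.

Definition decidable_pred k (P : seq nat -> bool) : Prop :=
  computable k (fun v => nat_of_bool (P v)).

Section Predicates.
Variable k : nat.
Implicit Types (A B : seq nat -> nat) (P Q : seq nat -> bool).

Lemma decidable_not P : decidable_pred k P -> decidable_pred k (fun v => ~~ P v).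
Proof.
move=> P_dec; have := computable_sub (computable_const k 1) P_dec.
by apply: computable_ext => v /=; case: (P v).
Qed.

Lemma decidable_and P Q : decidable_pred k P -> decidable_pred k Q ->
  decidable_pred k (fun v => P v && Q v).
Proof.
move=> P_dec Q_dec; have := computable_mul P_dec Q_dec.
by apply: computable_ext => v /=; case: (P v); case: (Q v).
Qed.

Lemma decidable_or P Q : decidable_pred k P -> decidable_pred k Q ->
  decidable_pred k (fun v => P v || Q v).
Proof.
move=> P_dec Q_dec.
have := decidable_not (decidable_and (decidable_not P_dec) (decidable_not Q_dec)).
by apply: computable_ext => v /=; rewrite negb_and !negbK.
Qed.

Lemma decidable_iff P Q : decidable_pred k P -> decidable_pred k Q ->
  decidable_pred k (fun v => P v == Q v).
Proof.
move=> P_dec Q_dec.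
have := decidable_or (decidable_and P_dec Q_dec)
  (decidable_and (decidable_not P_dec) (decidable_not Q_dec)).
by apply: computable_ext => v /=; case: (P v); case: (Q v).
Qed.

Lemma decidable_zero A : computable k A -> decidable_pred k (fun v => A v == 0).
Proof.
move=> A_comp.
have := computable_iter A_comp (computable_const k 1) (computable_const k.+2 0).
by apply: computable_ext => v; case: (A v).
Qed.

Lemma decidable_leq A B : computable k A -> computable k B ->
  decidable_pred k (fun v => A v <= B v).
Proof. by move=> A_comp B_comp; apply/decidable_zero/computable_sub. Qed.

Lemma decidable_eq A B : computable k A -> computable k B ->
  decidable_pred k (fun v => A v == B v).
Proof.
move=> A_comp B_comp.
have := decidable_and (decidable_leq A_comp B_comp) (decidable_leq B_comp A_comp).
by apply: computable_ext => v /=; rewrite eqn_leq.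
Qed.

Lemma computable_if P A B : decidable_pred k P -> computable k A ->
  computable k B -> computable k (fun v => if P v then A v else B v).
Proof.
move=> P_dec A_comp B_comp.
have := computable_add (computable_mul P_dec A_comp)
  (computable_mul (decidable_not P_dec) B_comp).
by apply: computable_ext => v; case: (P v); rewrite /= ?mul1n ?mul0n ?addn0.
Qed.

End Predicates.

Section Bounded.
Variables (k : nat) (B : seq nat -> nat).
Hypothesis B_comp : computable k B.

(** In a recursion, the accumulator stands between the counter and the
    parameters; a summand does not depend on it. *)
Lemma computable_skip2 F : computable k.+1 F ->
  computable k.+2 (fun v => F (head 0 v :: behead (behead v))).
Proof.
move=> F_comp.
pose Gs := (fun v => nth 0 v 0) :: [seq fun v => nth 0 v i.+2 | i <- iota 0 k].
have [] // := @computable_comp k.+2 F Gs.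
- by rewrite /= size_map size_iota.
- move=> [|i]; first by move=> _; apply: (computable_var k.+2 0).
  rewrite /= size_map size_iota ltnS => lt_ik.
  rewrite (nth_map 0) ?size_iota // nth_iota //.
  exact: (computable_var k.+2 i.+2).
move=> h hP; exists h => v; have := hP v; rewrite /= -map_comp nth0.
suff -> : [seq ((fun G0 => G0 v) \o (fun i v0 => nth 0 v0 i.+2)) i | i <- iota 0 k]
          = behead (behead v) :> seq nat by [].
apply: (@eq_from_nth _ 0).
  by rewrite size_map size_iota !size_behead size_tuple.
move=> i; rewrite size_map size_iota => lt_ik.
by rewrite (nth_map 0) ?size_iota //= nth_iota //= !nth_behead.
Qed.

Lemma computable_sum F : computable k.+1 F ->
  computable k (fun v => \sum_(0 <= a < B v) F (a :: v)).
Proof.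
move=> F_comp.
have := computable_iter B_comp (computable_const k 0)
  (computable_add (computable_var k.+2 1) (computable_skip2 F_comp)).
apply: computable_ext => v /=.
by elim: (B v) => [|b IHb]; rewrite ?big_nil //= big_nat_recr //= IHb.
Qed.

Lemma decidable_all P : decidable_pred k.+1 P ->
  decidable_pred k (fun v => all (fun a => P (a :: v)) (iota 0 (B v))).
Proof.
move=> P_dec; have := decidable_zero (computable_sum (decidable_not P_dec)).
apply: computable_ext => v; rewrite sum_nat_seq_eq0; congr (nat_of_bool _).
by rewrite /index_iota subn0; apply: eq_all => a /=; rewrite eqb0 negbK.
Qed.

Lemma decidable_has P : decidable_pred k.+1 P ->
  decidable_pred k (fun v => has (fun a => P (a :: v)) (iota 0 (B v))).
Proof.
move=> P_dec; have := decidable_not (decidable_all (decidable_not P_dec)).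
by apply: computable_ext => v; rewrite -has_predC; congr (nat_of_bool _);
  apply: eq_has => a /=; rewrite negbK.
Qed.

End Bounded.

Lemma decidable_dvdn k A B : computable k A -> computable k B ->
  decidable_pred k (fun v => A v %| B v).
Proof.
move=> A_comp B_comp.
pose P v := nth 0 v 0 * nth 0 v 1 == nth 0 v 2.
have P_dec : decidable_pred 3 P.
  apply: decidable_eq; last exact: computable_var.
  by apply: computable_mul; apply: computable_var.
apply: (@computable_app2 k A B A_comp B_comp (fun a b => nat_of_bool (a %| b))).
have := decidable_has (computable_succ (computable_var 2 1)) P_dec.
apply: computable_ext => v; congr (nat_of_bool _).
apply/hasP/dvdnP => [[q _ /eqP /= qv] | [q qv]]; first by exists q.
have [v0 | v0] := posnP (nth 0 v 0).
  by exists 0; rewrite // /P /= qv v0 !muln0.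
exists q; last by rewrite /P /= qv.
by rewrite mem_iota /= add0n ltnS qv leq_pmulr.
Qed.

Lemma decidable_prime k A : computable k A -> decidable_pred k (fun v => prime (A v)).
Proof.
move=> A_comp.
pose P v := ~~ (nth 0 v 0 %| nth 0 v 1) || (nth 0 v 0 == 1).
have P_dec : decidable_pred 2 P.
  apply: decidable_or.
    by apply/decidable_not/decidable_dvdn; apply: computable_var.
  by apply: decidable_eq; [apply: computable_var | apply: computable_const].
apply: (@computable_comp k (fun v => nat_of_bool (prime (nth 0 v 0))) [:: A]);
  last by case.
have := decidable_and
  (decidable_leq (computable_const 1 2) (computable_var 1 0))
  (decidable_all (computable_var 1 0) P_dec).
apply: computable_ext => v; congr (nat_of_bool _).
set p := nth 0 v 0; apply/andP/primeP => -[p_gt1 p_div]; split=> //.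
  move=> d dvd_dp; have := dvdn_leq (ltnW p_gt1) dvd_dp.
  rewrite leq_eqVlt orbC => /orP[lt_dp | /eqP->]; last by rewrite /= eqxx orbT.
  have /allP/(_ d) := p_div; rewrite mem_iota /P /= -/p dvd_dp => /(_ lt_dp).
  by move=> /= ->.
apply/allP=> d; rewrite mem_iota /P /= -/p => lt_dp.
by case: (boolP (d %| p)) => //= /p_div/orP[// | /eqP eq_dp]; lia.
Qed.

(** Bounded sums of tests count: quotients and valuations are thus obtained
    without any search. *)
Lemma sum_nat_ltn q n : q <= n -> \sum_(0 <= e < n) (e < q) = q.
Proof.
move=> le_qn; rewrite (big_cat_nat (n := q)) //=.
rewrite (eq_big_nat _ _ (F2 := fun=> 1)) => [|e /= ->//].
rewrite [X in _ + X](eq_big_nat _ _ (F2 := fun=> 0)) => [|e /andP[le_qe _]].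
  by rewrite !sum_nat_const_nat muln1 muln0 subn0 addn0.
by rewrite ltnNge le_qe.
Qed.

Lemma computable_div k A B : computable k A -> computable k B ->
  computable k (fun v => A v %/ B v).
Proof.
move=> A_comp B_comp; apply: (computable_app2 A_comp B_comp (F := divn)).
pose P v := (0 < nth 0 v 2) && ((nth 0 v 0).+1 * nth 0 v 2 <= nth 0 v 1).
have P_dec : decidable_pred 3 P.
  apply: decidable_and; apply: decidable_leq; try exact: computable_var.
    exact: computable_const.
  by apply: computable_mul; try apply: computable_succ; apply: computable_var.
have := computable_sum (computable_var 2 0) P_dec.
apply: computable_ext => v; rewrite /P /=.
move: (nth 0 v 0) (nth 0 v 1) => a [|d]; first by rewrite big1 ?divn0.
under eq_bigr => q _ do rewrite -leq_divRL //.
exact/sum_nat_ltn/leq_div.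
Qed.

(** * The decoding of the input *)

(** The code of [n :: s] is [2 ^ n * (2 * code s + 1)]. *)
Definition code_head c := \sum_(0 <= e < c) (2 ^ e.+1 %| c).
Definition code_tail c := c %/ 2 ^ (code_head c).+1.
Definition item c m := code_head (iter m code_tail c).

Lemma code_headE c : code_head c = logn 2 c.
Proof.
have [-> | c_gt0] := posnP c; first by rewrite logn0 /code_head big_nil.
rewrite /code_head; under eq_bigr => e _ do rewrite pfactor_dvdn //.
exact/sum_nat_ltn/ltnW/ltn_logl.
Qed.

Lemma code_head_leq c : code_head c <= c.
Proof.
rewrite code_headE; case: c => [|c]; first by rewrite logn0.
exact/ltnW/ltn_logl.
Qed.

Lemma item_leq c m : item c m <= c.
Proof.
apply: leq_trans (code_head_leq _) _.
by elim: m => //= m IHm; apply: leq_trans (leq_div _ _) IHm.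
Qed.

Lemma code_head_cons n s : code_head (CodeSeq.code (n :: s)) = n.
Proof.
rewrite code_headE /= lognM ?expn_gt0 // pfactorK // -[RHS]addn0; congr (_ + _).
by rewrite logn_coprime // coprime2n /= odd_double.
Qed.

Lemma code_tail_cons n s : code_tail (CodeSeq.code (n :: s)) = CodeSeq.code s.
Proof.
rewrite /code_tail code_head_cons /= expnSr divnMA mulKn ?expn_gt0 //.
by rewrite divn2 /= uphalf_double.
Qed.

Lemma item_code s m : m < size s -> item (CodeSeq.code s) m = nth 0 s m.
Proof.
rewrite /item; elim: s m => [|n s IHs] [|m] // lt_ms; first exact: code_head_cons.
by rewrite iterSr code_tail_cons IHs.
Qed.

Lemma computable_item k A B : computable k A -> computable k B ->
  computable k (fun v => item (A v) (B v)).
Proof.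
move=> A_comp B_comp; apply: (computable_app2 A_comp B_comp (F := item)).
have head_comp j i : computable j (fun v => code_head (nth 0 v i)).
  apply: (@computable_comp j (fun v => code_head (nth 0 v 0))
    [:: fun v => nth 0 v i]); last by case=> // _; apply: computable_var.
  pose P v := 2 ^ (nth 0 v 0).+1 %| nth 0 v 1.
  suff: decidable_pred 2 P by apply: (computable_sum (computable_var 1 0)).
  apply: decidable_dvdn; last exact: computable_var.
  apply: computable_exp; first exact: computable_const.
  exact/computable_succ/computable_var.
have tail_comp : computable 4 (fun v => code_tail (nth 0 v 1)).
  apply: computable_div; first exact: computable_var.
  apply: computable_exp; first exact: computable_const.
  exact/computable_succ/head_comp.
pose iter_tail v := iter (nth 0 v 1) code_tail (nth 0 v 0).
have iter_comp : computable 2 iter_tail.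
  have := computable_iter (computable_var 2 1) (computable_var 2 0) tail_comp.
  apply: computable_ext => v; rewrite /iter_tail /=.
  by elim: (nth 0 v 1) => //= b ->.
apply: (@computable_comp 2 (fun v => code_head (nth 0 v 0)) [:: iter_tail]).
  exact: (head_comp 1 0).
by case.
Qed.

(** [int_code] sends [m] to [2 * m] and [- (m + 1)] to [2 * m + 1]. *)
Definition code_pos z := if 2 %| z then z %/ 2 else 0.
Definition code_neg z := if 2 %| z then 0 else z.+1 %/ 2.

Lemma int_code_parts (z : int) :
  ((code_pos (int_code z))%:Z - (code_neg (int_code z))%:Z)%R = z.
Proof.
rewrite /code_pos /code_neg !dvdn2; case: z => m /=; rewrite odd_double /=.
  by rewrite divn2 doubleK GRing.subr0.
by rewrite divn2 -doubleS doubleK GRing.add0r NegzE.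
Qed.

Lemma int_code_bound (z : int) : `|z|%N <= int_code z.
Proof. by case: z => m /=; lia. Qed.

(** Positive and negative terms are kept apart, subtraction of natural numbers
    being truncated. *)
Definition code_det_pos a b a' b' :=
  (code_pos a * code_pos b' + code_neg a * code_neg b')
  + (code_pos b * code_neg a' + code_neg b * code_pos a').
Definition code_det_neg a b a' b' :=
  (code_pos a * code_neg b' + code_neg a * code_pos b')
  + (code_pos b * code_pos a' + code_neg b * code_neg a').
Definition code_det a b a' b' :=
  (code_det_pos a b a' b' - code_det_neg a b a' b')
  + (code_det_neg a b a' b' - code_det_pos a b a' b').

Lemma code_detE (x y x' y' : int) :
  code_det (int_code x) (int_code y) (int_code x') (int_code y')
  = `|(x * y' - y * x')%R|%N.
Proof.
rewrite -{2}(int_code_parts x) -{2}(int_code_parts y) -{2}(int_code_parts x').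
rewrite -{2}(int_code_parts y') /code_det.
set P := code_det_pos _ _ _ _; set N := code_det_neg _ _ _ _.
transitivity `|(P%:Z - N%:Z)%R|%N; first lia.
congr absz; rewrite /P /N /code_det_pos /code_det_neg !PoszD !PoszM; ring.
Qed.

(** * The test *)

(** The input starts with [n], followed by the four coordinates of each pair
    [u j], [v j].  The number [n] stands for one more pair, the canonical basis,
    whose coordinates are given here by their codes. *)
Definition coord c j r :=
  if j < item c 0 then item c (4 * j + r).+1 else nth 0 [:: 2; 0; 0; 2] r.

Definition coord_det c i r j r' :=
  code_det (coord c i r) (coord c i r.+1) (coord c j r') (coord c j r'.+1).

(** An item never exceeds the code, so that coordinates are at most [c] and
    determinants at most [2 * c ^ 2]. *)
Definition bound c := (2 * c ^ 2).+1.

(** The contents of [u i] and [v i] in the lattice of the pair [j] are either both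
    divisible by [p ^ e] or both not. *)
Definition same_power e i j p c :=
  ((p ^ e %| coord_det c i 0 j 0) && (p ^ e %| coord_det c i 0 j 2))
  == ((p ^ e %| coord_det c i 2 j 0) && (p ^ e %| coord_det c i 2 j 2)).

Definition balances j p c :=
  (coord_det c j 0 j 2 != 0) &&
  all (fun i => all (fun e => same_power e i j p c) (iota 0 (bound c)))
    (iota 0 (item c 0)).

Definition rf_test c :=
  all (fun p => ~~ prime p || has (fun j => balances j p c) (iota 0 (item c 0).+1))
    (iota 0 (bound c)).

Lemma computable_coord k C J r : computable k C -> computable k J ->
  computable k (fun v => coord (C v) (J v) r).
Proof.
move=> C_comp J_comp; apply: computable_if; last exact: computable_const.
  apply: decidable_leq; first exact: computable_succ.
  by apply: computable_item => //; apply: computable_const.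
apply: computable_item => //; apply/computable_succ/computable_add.
  by apply: computable_mul => //; apply: computable_const.
exact: computable_const.
Qed.

Lemma computable_code_pos k A : computable k A -> computable k (fun v => code_pos (A v)).
Proof.
move=> A_comp; apply: computable_if; last exact: computable_const.
  by apply: decidable_dvdn => //; apply: computable_const.
by apply: computable_div => //; apply: computable_const.
Qed.

Lemma computable_code_neg k A : computable k A -> computable k (fun v => code_neg (A v)).
Proof.
move=> A_comp; apply: computable_if; first 1 last.
- exact: computable_const.
- apply: computable_div; last exact: computable_const.
  exact: computable_succ.
by apply: decidable_dvdn => //; apply: computable_const.
Qed.

Lemma computable_coord_det k C I J r r' :
  computable k C -> computable k I -> computable k J ->
  computable k (fun v => coord_det (C v) (I v) r (J v) r').
Proof.
move=> C_comp I_comp J_comp.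
have pos_comp M s : computable k M ->
    computable k (fun v => code_pos (coord (C v) (M v) s)).
  by move=> M_comp; apply/computable_code_pos/computable_coord.
have neg_comp M s : computable k M ->
    computable k (fun v => code_neg (coord (C v) (M v) s)).
  by move=> M_comp; apply/computable_code_neg/computable_coord.
have P_comp : computable k (fun v => code_det_pos (coord (C v) (I v) r)
  (coord (C v) (I v) r.+1) (coord (C v) (J v) r') (coord (C v) (J v) r'.+1)).
  by apply: computable_add; apply: computable_add; apply: computable_mul; auto.
have N_comp : computable k (fun v => code_det_neg (coord (C v) (I v) r)
  (coord (C v) (I v) r.+1) (coord (C v) (J v) r') (coord (C v) (J v) r'.+1)).
  by apply: computable_add; apply: computable_add; apply: computable_mul; auto.
by apply: computable_add; apply: computable_sub.
Qed.

Lemma computable_bound k C : computable k C -> computable k (fun v => bound (C v)).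
Proof.
move=> C_comp; apply/computable_succ/computable_mul; first exact: computable_const.
by apply: computable_exp => //; apply: computable_const.
Qed.

Lemma decidable_same_power : decidable_pred 5 (fun v =>
  same_power (nth 0 v 0) (nth 0 v 1) (nth 0 v 2) (nth 0 v 3) (nth 0 v 4)).
Proof.
have pow_comp : computable 5 (fun v => nth 0 v 3 ^ nth 0 v 0).
  by apply: computable_exp; apply: computable_var.
by apply: decidable_iff; apply: decidable_and; apply: decidable_dvdn => //;
  apply: computable_coord_det; apply: computable_var.
Qed.

Lemma decidable_balances : decidable_pred 3 (fun v =>
  balances (nth 0 v 0) (nth 0 v 1) (nth 0 v 2)).
Proof.
apply: decidable_and.
  apply/decidable_not/decidable_zero.
  by apply: computable_coord_det; apply: computable_var.
pose P v := all (fun e => same_power e (nth 0 v 0) (nth 0 v 1) (nth 0 v 2) (nth 0 v 3))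
  (iota 0 (bound (nth 0 v 3))).
apply: (decidable_all _ (P := P)).
  by apply: computable_item; [apply: computable_var | apply: computable_const].
apply: (decidable_all _ decidable_same_power).
exact/computable_bound/computable_var.
Qed.

Lemma decidable_rf_test : decidable_pred 1 (fun v => rf_test (nth 0 v 0)).
Proof.
pose P v := ~~ prime (nth 0 v 0) ||
  has (fun j => balances j (nth 0 v 0) (nth 0 v 1)) (iota 0 (item (nth 0 v 1) 0).+1).
apply: (decidable_all _ (P := P)); first exact/computable_bound/computable_var.
apply: decidable_or; first exact/decidable_not/decidable_prime/computable_var.
apply: (decidable_has _ decidable_balances).
by apply/computable_succ/computable_item;
  [apply: computable_var | apply: computable_const].
Qed.

(** * Determinants and contents in the plane *)

Import Order.TTheory GRing.Theory Num.Theory.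
Local Open Scope ring_scope.

Lemma scalez_eq0 (k : int) (x : 'rV[int]_2) :
  (k *: x == 0) = (k == 0) || (x == 0).
Proof.
apply/idP/idP=> [/eqP kx0 | ]; last first.
  by case/orP=> /eqP eq0; rewrite eq0 ?scale0r ?scaler0.
apply/orP; have [_ | k_neq0] := eqVneq k 0; [by left | right; apply/eqP/rowP => j].
have /rowP/(_ j)/eqP := kx0; rewrite !mxE mulf_eq0 (negPf k_neq0) /=.
by move/eqP.
Qed.

Section Plane.
Implicit Types x y s t u v : 'rV[int]_2.

Definition det x y : int := x 0 0 * y 0 1 - x 0 1 * y 0 0.

Lemma ord2P (j : 'I_2) : j = 0 \/ j = 1.
Proof. by case: j => [[|[|]]] // lt_j2; [left | right]; apply: val_inj. Qed.

Lemma row2_ext (R : Type) (x y : 'rV[R]_2) : x 0 0 = y 0 0 -> x 0 1 = y 0 1 -> x = y.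
Proof. by move=> eq0 eq1; apply/rowP => j; case: (ord2P j) => ->. Qed.

Lemma detDl x y z : det (x + y) z = det x z + det y z.
Proof. by rewrite /det !mxE; ring. Qed.

Lemma detBl x y z : det (x - y) z = det x z - det y z.
Proof. by rewrite /det !mxE; ring. Qed.

Lemma detZl k x z : det (k *: x) z = k * det x z.
Proof. by rewrite /det !mxE; ring. Qed.

Lemma detDr x y z : det z (x + y) = det z x + det z y.
Proof. by rewrite /det !mxE; ring. Qed.

Lemma detZr k x z : det z (k *: x) = k * det z x.
Proof. by rewrite /det !mxE; ring. Qed.

Lemma detC x y : det x y = - det y x.
Proof. by rewrite /det; ring. Qed.

Lemma detxx x : det x x = 0.
Proof. by rewrite /det; ring. Qed.

Lemma det_expand s t x : det s t *: x = det x t *: s - det x s *: t.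
Proof. by apply: row2_ext; rewrite !mxE /det; ring. Qed.

Lemma det_plucker s t x y :
  det s t * det x y = det x t * det s y - det x s * det t y.
Proof. by rewrite /det; ring. Qed.

(** When [s], [t] is a basis of a lattice, [x] has coordinates [det x t] and
    [- det x s] divided by [det s t] in this basis; the gcd of the coordinates is
    the content of [x] in the lattice, and the present integer is that content
    without the denominator. *)
Definition cont s t x : nat := gcdn `|det x s| `|det x t|.

Lemma dvdn_cont d s t x :
  (d %| cont s t x)%N = (d%:Z %| det x s)%Z && (d%:Z %| det x t)%Z.
Proof. by rewrite dvdn_gcd !dvdzE. Qed.

Lemma contC s t x : cont s t x = cont t s x.
Proof. exact: gcdnC. Qed.

Lemma contZ s t k x : cont s t (k *: x) = (`|k| * cont s t x)%N.
Proof. by rewrite /cont !detZl !abszM muln_gcdr. Qed.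

Lemma cont_gt0 s t x : det s t != 0 -> x != 0 -> (0 < cont s t x)%N.
Proof.
move=> st_neq0 x_neq0; rewrite gcdn_gt0 !absz_gt0 -negb_and.
apply: contra x_neq0 => /andP[/eqP xs0 /eqP xt0].
have := det_expand s t x; rewrite xs0 xt0 !scale0r subr0 => /eqP.
by rewrite scalez_eq0 (negPf st_neq0).
Qed.

(** By [det_plucker], [det s t * det x y] is a combination of [det x s] and
    [det x t] whose coefficients, for [y] one of [u], [v], are multiples of
    [p ^ e]. *)
Lemma logn_cont_leq p e s t u v x : prime p ->
  det s t != 0 -> det u v != 0 -> x != 0 ->
  (p ^ e %| cont u v s)%N -> (p ^ e %| cont u v t)%N ->
  (logn p (cont s t x) + e <= logn p (cont u v x) + logn p `|det s t|)%N.
Proof.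
move=> p_prime st_neq0 uv_neq0 x_neq0.
rewrite !dvdn_cont => /andP[su sv] /andP[tu tv].
have st_gt0 : (0 < `|det s t|)%N by rewrite absz_gt0.
rewrite -lognM ?cont_gt0 // -pfactor_dvdn ?muln_gt0 ?cont_gt0 //.
have: (p ^ logn p (cont s t x) %| cont s t x)%N by apply: pfactor_dvdnn.
rewrite dvdn_cont expnD => /andP[xs xt].
have dvd_comb y : ((p ^ e)%N%:Z %| det s y)%Z -> ((p ^ e)%N%:Z %| det t y)%Z ->
  (p ^ logn p (cont s t x) * p ^ e %| `|det x y| * `|det s t|)%N.
  move=> sy ty; rewrite [X in (_ %| X)%N]mulnC -abszM det_plucker.
  have: ((p ^ logn p (cont s t x) * p ^ e)%N%:Z
         %| det x t * det s y - det x s * det t y)%Z.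
    by rewrite PoszM; apply: rpredB; apply: dvdz_mul.
  by rewrite dvdzE.
by rewrite /cont muln_gcdl dvdn_gcd !dvd_comb.
Qed.

End Plane.

(** * The local condition, and its finite form *)

Section Local.
Variables (I : Type) (u v : I -> 'rV[int]_2) (p : nat).
Hypotheses (u_neq0 : forall i, u i != 0) (v_neq0 : forall i, v i != 0).
Hypothesis p_prime : prime p.

Definition balanced_at (s t : 'rV[int]_2) : Prop :=
  det s t != 0 /\ forall i, logn p (cont s t (u i)) = logn p (cont s t (v i)).

Lemma row2_divz (d : int) (x : 'rV[int]_2) :
  (d %| x 0%R 0%R)%Z -> (d %| x 0%R 1%R)%Z -> exists y, x = d *: y.
Proof.
move=> d0 d1; exists (\row_j (x 0%R j %/ d)%Z).
by apply: row2_ext; rewrite !mxE mulrC divzK.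
Qed.

(** When [p] divides [det s t], the vectors [s] and [t] are dependent modulo [p],
    so that a unimodular change of basis makes one of them divisible by [p];
    contents are insensitive to such a change.  Replacing [p t0] by [t0] is a
    step towards [Z^2] in the tree of lattices. *)
Lemma sublattice_step (s t : 'rV[int]_2) : (p %| `|det s t|)%N ->
  exists s0 t0 : 'rV[int]_2, `|det s t|%N = (p * `|det s0 t0|)%N /\
    forall x, cont s t x = cont s0 (p%:Z *: t0) x.
Proof.
move=> p_dvd.
have [tp | [r rt]] : (exists t0, t = p%:Z *: t0) \/ exists r, ~~ (p%:Z %| t 0%R r)%Z.
- have [t0 | ] := boolP (p%:Z %| t 0%R 0%R)%Z; last by right; exists 0.
  have [t1 | ] := boolP (p%:Z %| t 0%R 1%R)%Z; last by right; exists 1.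
  by left; apply: row2_divz.
- by case: tp => t0 ->; exists s, t0; rewrite detZr abszM.
have /coprimezP[[k l] /= kl] : coprimez (t 0 r) p%:Z.
  by rewrite coprimezE /= coprime_sym prime_coprime //
    -[p in (p %| _)%N]/(`|p%:Z|)%N -dvdzE.
pose a := - s 0 r * k.
have dvd_sat q : (p%:Z %| (s + a *: t)%R 0%R q)%Z.
  have -> : (s + a *: t) 0 q =
    (k * (s 0 q * t 0 r - s 0 r * t 0 q)
      + l * s 0 q * p%:Z).
    rewrite !mxE /a -[X in X + _ = _]mulr1 -kl; ring.
  rewrite rpredD ?dvdz_mull //.
  have [->|] := eqVneq q r; first by rewrite subrr dvdz0.
  move=> neq_qr; have: `|det s t|%N = `|(s 0 q * t 0 r - s 0 r * t 0 q)%R|%N.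
    by case: (ord2P q) (ord2P r) neq_qr => -> [] -> //; rewrite /det; lia.
  by move=> abs_eq; rewrite dvdzE -abs_eq.
have [s0 def_s0] := row2_divz (dvd_sat 0) (dvd_sat 1).
exists t, s0; split.
  have: `|(p%:Z * det t s0)%R|%N = `|det s t|%N.
    by rewrite -detZr -def_s0 detDr detZr detxx mulr0 addr0 detC abszN.
  by rewrite abszM => <-.
move=> x; rewrite -def_s0 contC /cont detDr detZr addrC.
by have [->] := gcdzMDl a (det x t) (det x s).
Qed.

(** The lattice [s], [p t] is balanced at the pair [x], [y] but the next one,
    [s], [t], is not.  This forces the valuations of the coordinates of [x] and
    [y] in [s], [p t]: up to a power of [p] they form a matrix invertible modulo
    [p], one entry being divisible by [p] and its two neighbours not.  Hence [x],
    [y] span the lattice [s], [p t] up to scaling at [p], and give proportional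
    contents. *)
Lemma logn_cont_exit s t x y :
  det s t != 0 -> x != 0 -> y != 0 ->
  logn p (cont s (p%:Z *: t) x) = logn p (cont s (p%:Z *: t) y) ->
  (logn p (cont s t x) < logn p (cont s t y))%N ->
  exists c d : nat, det x y != 0 /\
    forall z, z != 0 -> (logn p (cont x y z) + c = logn p (cont s (p%:Z *: t) z) + d)%N.
Proof.
move=> st_neq0 x_neq0 y_neq0 eq_e lt_xy; set t1 := p%:Z *: t in eq_e *.
have p_neq0 : p%:Z != 0 by rewrite -absz_gt0 prime_gt0.
have st1_neq0 : det s t1 != 0 by rewrite detZr mulf_neq0.
set e := logn p (cont s t1 y) in eq_e *.
have cont_dvd s' t' z m : det s' t' != 0 -> z != 0 -> (m <= logn p (cont s' t' z))%N =
    ((p ^ m)%N%:Z %| det z s')%Z && ((p ^ m)%N%:Z %| det z t')%Z.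
  by move=> st'_neq0 z_neq0; rewrite -dvdn_cont pfactor_dvdn ?cont_gt0.
have dvd_t1 m z : ((p ^ m.+1)%N%:Z %| det z t1)%Z = ((p ^ m)%N%:Z %| det z t)%Z.
  by rewrite detZr !dvdzE abszM expnS dvdn_pmul2l // prime_gt0.
have dvd_le m m' z : (m' <= m)%N -> ((p ^ m)%N%:Z %| z)%Z -> ((p ^ m')%N%:Z %| z)%Z.
  by move=> le_m; apply: dvdz_trans; rewrite dvdzE dvdn_exp2l.
have /andP[xs xt1] : ((p ^ e)%N%:Z %| det x s)%Z && ((p ^ e)%N%:Z %| det x t1)%Z.
  by rewrite -cont_dvd // eq_e.
have /andP[ys yt1] : ((p ^ e)%N%:Z %| det y s)%Z && ((p ^ e)%N%:Z %| det y t1)%Z.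
  by rewrite -cont_dvd.
have le_y : (logn p (cont s t y) <= e)%N.
  rewrite cont_dvd //; have := leqnn (logn p (cont s t y)).
  rewrite cont_dvd // => /andP[-> yt]; rewrite /= detZr.
  exact: dvdz_mull.
have Nxt : ~~ ((p ^ e)%N%:Z %| det x t)%Z.
  apply: contraL lt_xy => xt; rewrite -leqNgt; apply: leq_trans le_y _.
  by rewrite cont_dvd // xs.
have eq_y : logn p (cont s t y) = e.
  apply/eqP; rewrite eqn_leq le_y; move: xt1 Nxt.
  case: (e) xs ys => [// | m] xs ys; rewrite dvd_t1 => xt _.
  apply: leq_ltn_trans lt_xy; rewrite cont_dvd // xt andbT.
  exact: dvd_le xs.
have yt : ((p ^ e)%N%:Z %| det y t)%Z.
  by have := leqnn e; rewrite -{2}eq_y cont_dvd // => /andP[].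
have Nys : ~~ ((p ^ e.+1)%N%:Z %| det y s)%Z.
  apply/negP => ys'; have := ltnn e; rewrite -{2}/e cont_dvd //.
  by rewrite ys' dvd_t1 yt.
(* The determinants of [x] with [p t] and of [y] with [s] have valuation exactly
   [e]: their product dominates in [det_plucker], which yields the valuation of
   [det x y]. *)
have val_det m a : ((p ^ m)%N%:Z %| a)%Z -> ~~ ((p ^ m.+1)%N%:Z %| a)%Z ->
    a != 0 /\ logn p `|a| = m.
  move=> dvd_a Ndvd_a; have a_neq0 : a != 0.
    by apply: contraNneq Ndvd_a => ->; rewrite dvdz0.
  move: dvd_a Ndvd_a; rewrite !dvdzE !pfactor_dvdn ?absz_gt0 // -ltnNge ltnS.
  by move=> le_ma le_am; split=> //; apply/eqP; rewrite eqn_leq le_am.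
have [xt1_neq0 val_xt1] : det x t1 != 0 /\ logn p `|det x t1| = e.
  by apply: val_det; rewrite ?dvd_t1.
have [ys_neq0 val_ys] : det y s != 0 /\ logn p `|det y s| = e by apply: val_det.
have dvd_N m a b : ((p ^ m)%N%:Z %| det a b)%Z -> ((p ^ m)%N%:Z %| det b a)%Z.
  by rewrite detC dvdzE abszN -dvdzE.
have [prod_neq0 val_prod] :
    det s t1 * det x y != 0 /\ logn p `|det s t1 * det x y| = (e + e)%N.
  rewrite det_plucker; apply: val_det.
    by rewrite expnD PoszM; apply: rpredB; apply: dvdz_mul => //; apply: dvd_N.
  have dvd_b : ((p ^ (e + e).+1)%N%:Z %| det x s * det t1 y)%Z.
    by rewrite -addnS expnD PoszM; apply: dvdz_mul => //; apply: dvd_N; rewrite dvd_t1.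
  apply/negP => /rpredD/(_ dvd_b); rewrite subrK dvdzE abszM [det s y]detC abszN.
  rewrite absz_nat pfactor_dvdn ?muln_gt0 ?absz_gt0 ?xt1_neq0 //.
  by rewrite lognM ?absz_gt0 // val_xt1 val_ys ltnn.
move: prod_neq0; rewrite mulf_eq0 negb_or => /andP[_ xy_neq0].
exists (logn p `|det s t1|), e; split=> // z z_neq0.
move: val_prod; rewrite abszM lognM ?absz_gt0 // => val_prod.
have := @logn_cont_leq p e s t1 x y z p_prime st1_neq0 xy_neq0 z_neq0.
have := @logn_cont_leq p e x y s t1 z p_prime xy_neq0 st1_neq0 z_neq0.
rewrite !dvdn_cont xs xt1 ys yt1 !(dvd_N _ _ _ xs, dvd_N _ _ _ ys, dvd_N _ _ _ xt1,
  dvd_N _ _ _ yt1) => /(_ isT isT) le1 /(_ isT isT) le2.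
move: le1 le2 val_prod; move: (logn p (cont x y z)) (logn p (cont s t1 z)) (e).
by move: (logn p `|det s t1|) (logn p `|det x y|); clear; lia.
Qed.

Definition e1 : 'rV[int]_2 := delta_mx 0 0.
Definition e2 : 'rV[int]_2 := delta_mx 0 1.

Lemma det_e : det e1 e2 = 1.
Proof. by rewrite /det !mxE. Qed.

(** Homothety classes of lattices at [p] are the vertices of a tree.  Those
    balanced at independent [u i], [v i] form a subtree, bounded by edges at the
    class of [u i], [v i] itself; for dependent vectors, it is all or nothing.
    Walking from any class balanced at all the pairs towards that of [Z^2], the
    last such class is that of [Z^2] or, by [logn_cont_exit], of some [u j],
    [v j]. *)
Lemma balanced_finite s t : balanced_at s t ->
  balanced_at e1 e2 \/ exists j, balanced_at (u j) (v j).
Proof.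
have [m] := ubnP `|det s t|; elim: m s t => // m IHm s t lt_stm [st_neq0 bal_st].
have [p_dvd | p_ndvd] := boolP (p %| `|det s t|)%N; last first.
  have val_st : logn p `|det s t| = 0%N.
    by rewrite lognE (negPf p_ndvd) !andbF.
  have e_neq0 : det e1 e2 != 0 by rewrite det_e.
  left; split=> // i.
  suff val_e x : x != 0 -> logn p (cont e1 e2 x) = logn p (cont s t x).
    by rewrite !val_e.
  move=> x_neq0; apply/eqP; rewrite eqn_leq.
  have := @logn_cont_leq p 0 s t e1 e2 x p_prime st_neq0 e_neq0 x_neq0.
  have := @logn_cont_leq p 0 e1 e2 s t x p_prime e_neq0 st_neq0 x_neq0.
  rewrite !dvd1n det_e val_st logn1 !addn0 => -> // ->//.
have [s0 [t0 [det_st cont_st]]] := sublattice_step p_dvd.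
have p_gt1 := prime_gt1 p_prime.
have st0_gt0 : (0 < `|det s0 t0|)%N.
  by move: st_neq0; rewrite -absz_gt0 det_st; case: `|det s0 t0|%N => //; rewrite muln0.
have st0_neq0 : det s0 t0 != 0 by rewrite -absz_gt0.
have [bal_st0 | ] :=
    pselect (forall i, logn p (cont s0 t0 (u i)) = logn p (cont s0 t0 (v i))).
  apply: (IHm s0 t0) => //; rewrite -ltnS; apply: leq_trans lt_stm.
  by rewrite det_st ltnS ltn_Pmull.
move=> /existsNP[j /eqP]; rewrite neq_ltn => exit_j; right; exists j.
have [c [d [uv_neq0 cont_uv]]] : exists c d : nat, det (u j) (v j) != 0 /\ forall z,
    z != 0 -> (logn p (cont (u j) (v j) z) + c = logn p (cont s t z) + d)%N.
  case/orP: exit_j => lt_uv.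
    have [|||c [d [det_neq0 cont_uv]]] := logn_cont_exit st0_neq0 _ _ _ lt_uv => //.
      by rewrite -!cont_st.
    by exists c, d; split=> // z /cont_uv; rewrite -cont_st.
  have [|||c [d [det_neq0 cont_uv]]] := logn_cont_exit st0_neq0 _ _ _ lt_uv => //.
    by rewrite -!cont_st.
  exists c, d; split; first by rewrite detC oppr_eq0.
  by move=> z /cont_uv; rewrite -cont_st contC.
split=> // i; apply/eqP; rewrite -(eqn_add2r c) !cont_uv //; apply/eqP.
by rewrite bal_st.
Qed.

End Local.

(** * Balanced subgroups of the vertex group *)

Section Subgroups.
Variables (n : nat) (u v : 'I_n -> 'rV[int]_2).
Hypotheses (u_neq0 : forall i, u i != 0) (v_neq0 : forall i, v i != 0).

(** Indexed so that [edge i (~~ e)] is the conjugate [s * edge i e * s^-1] for [s]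
    the [i]-th stable letter, or its inverse when [e] is true. *)
Definition edge (i : 'I_n) (e : bool) : 'rV[int]_2 := if e then u i else v i.

Lemma edge_neq0 i e : edge i e != 0.
Proof. by case: e; rewrite /edge. Qed.

(** The finite-index subgroups modulo which the stable letters still conjugate
    cyclic groups of equal orders, that is, the traces on [Z^2] of the kernels
    of the finite quotients. *)
Record balanced_subgroup (L : 'rV[int]_2 -> Prop) : Prop := BalancedSubgroup {
  balancedB : forall x y, L x -> L y -> L (x - y);
  balanced_index : exists2 d : nat, (0 < d)%N & forall x, L (d%:Z *: x);
  balanced_edge : forall i k, L (k *: u i) <-> L (k *: v i) }.

Definition edge_separable : Prop :=
  (forall x, x != 0 -> exists2 L, balanced_subgroup L & ~ L x) /\
  (forall i e x, (forall k, x <> k *: edge i e) ->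
    exists2 L, balanced_subgroup L & forall k, ~ L (x - k *: edge i e)).

Lemma balancedT : balanced_subgroup (fun=> True).
Proof. by split=> //; exists 1%N. Qed.

Lemma balanced_bigcap (T : finType) (L : T -> 'rV[int]_2 -> Prop) :
  (forall t, balanced_subgroup (L t)) -> balanced_subgroup (fun x => forall t, L t x).
Proof.
move=> L_bal; split=> [x y Lx Ly t||i k].
- by apply: balancedB.
- have /fin_all_exists[d dP] (t : T) :
      exists d : nat, (0 < d)%N /\ forall x, L t (d%:Z *: x).
    by have [d] := balanced_index (L_bal t); exists d.
  exists (\prod_t d t)%N => [|x t]; first by rewrite prodn_gt0 // => t; case: (dP t).
  by rewrite (bigD1 t) //= PoszM -scalerA; case: (dP t).
- by split=> L_edge t; apply/(balanced_edge (L_bal t)).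
Qed.

(** The index of the group of [w] in the group of integer points of its line. *)
Definition divisor (w : 'rV[int]_2) : nat := gcdn `|w 0 0| `|w 0 1|.

Lemma divisor_gt0 w : w != 0 -> (0 < divisor w)%N.
Proof.
apply: contraNltn; rewrite leqn0 /divisor -[_ == _]/(gcdn _ _ == 0%N).
rewrite -leqn0 leqNgt gcdn_gt0 negb_or -!leqNgt !leqn0 !absz_eq0.
by case/andP=> /eqP w0 /eqP w1; apply/eqP/row2_ext; rewrite !mxE.
Qed.

(** Bezout coefficients [a], [b] of [divisor w] make [m] a linear form in [x],
    equal to [divisor w] at [w]. *)
Lemma collinear x w : det x w = 0 -> exists m, (divisor w)%:Z *: x = m *: w.
Proof.
move=> xw0; have [a [b ab]] := Bezoutz (w 0 0) (w 0 1).
exists (a * x 0 0 + b * x 0 1); rewrite /divisor -[X in X *: _]/(gcdz _ _) -ab.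
have xw : x 0 0 * w 0 1 = x 0 1 * w 0 0 by apply/eqP; rewrite -subr_eq0; apply/eqP.
apply: row2_ext; rewrite !mxE.
  transitivity (a * w 0 0 * x 0 0 + b * (x 0 0 * w 0 1)); first ring.
  by rewrite xw; ring.
transitivity (a * (x 0 1 * w 0 0) + b * w 0 1 * x 0 1); first ring.
by rewrite -xw; ring.
Qed.

Lemma scalezI (k : int) : k != 0 -> injective (fun x : 'rV[int]_2 => k *: x).
Proof.
move=> k_neq0 x y /eqP; rewrite -subr_eq0 -scalerBr scalez_eq0 (negPf k_neq0) subr_eq0.
by move/eqP.
Qed.

Lemma scalez_inj (w : 'rV[int]_2) : w != 0 -> injective (fun k : int => k *: w).
Proof.
move=> w_neq0 k l /eqP; rewrite -subr_eq0 -scalerBl scalez_eq0 (negPf w_neq0) orbF.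
by rewrite subr_eq0 => /eqP.
Qed.

Definition saturated (L : 'rV[int]_2 -> Prop) w : Prop :=
  forall x, L x -> det x w = 0 -> exists k, x = k *: w.

(** The integer points of the line of an edge group are finitely many modulo
    that group, and finitely many balanced subgroups separate them from it. *)
Lemma saturated_edge i e : edge_separable ->
  exists2 L, balanced_subgroup L & saturated L (edge i e).
Proof.
move=> [_ sep]; set w := edge i e; have w_neq0 : w != 0 := edge_neq0 i e.
have P_gt0 := divisor_gt0 w_neq0.
have /fin_all_exists[L LP] (r : 'I_(divisor w)) : exists L, balanced_subgroup L /\
  forall x, (divisor w)%:Z *: x = (r : nat)%:Z *: w -> (0 < r)%N ->
    forall k, ~ L (x - k *: w).
- have [[x [xr r_gt0]] | no_x] := pselect (exists x,
      (divisor w)%:Z *: x = (r : nat)%:Z *: w /\ (0 < r)%N); last first.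
    exists (fun=> True); split; first exact: balancedT.
    by move=> x xr r_gt0; case: no_x; exists x.
  have [k xk|L L_bal LP] := sep i e x.
    (* If [x = k *: w] then [divisor w * k = r], against [0 < r < divisor w]. *)
    have : (divisor w)%:Z * k = (r : nat)%:Z.
      by apply: (scalez_inj w_neq0); rewrite -scalerA -xr xk.
    move=> Pk; have : (divisor w %| r)%N.
      suff : ((divisor w)%:Z %| (r : nat)%:Z)%Z by rewrite dvdzE.
      by apply/dvdzP; exists k; rewrite mulrC.
    by move/(dvdn_leq r_gt0); rewrite leqNgt ltn_ord.
  exists L; split=> // y yr _; suff -> : y = x by [].
  by apply: (@scalezI (divisor w)); rewrite /= ?xr // -lt0n.
exists (fun x => forall r, L r x) => [|x Lx xw].
  by apply: balanced_bigcap => r; case: (LP r).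
have [m xm] := collinear xw.
have r_lt : (`|(m %% divisor w)%Z| < divisor w)%N.
  by rewrite -ltz_nat gez0_abs ?modz_ge0 ?ltz_pmod // -?lt0n.
have [_ /(_ (x - (m %/ divisor w)%Z *: w))] := LP (Ordinal r_lt).
rewrite /= gez0_abs ?modz_ge0 -?lt0n // => LP'.
have [m0 | m_neq0] := eqVneq (m %% divisor w)%Z 0.
  exists (m %/ divisor w)%Z; apply: (@scalezI (divisor w)); rewrite -?lt0n //=.
  by rewrite xm scalerA {1}(divz_eq m (divisor w)) m0 addr0 mulrC.
case: (LP' _ _ (- (m %/ divisor w)%Z)).
- rewrite scalerBr xm scalerA -scalerBl; congr (_ *: _).
  by rewrite {1}(divz_eq m (divisor w)); ring.
- by rewrite absz_gt0.
- by rewrite scaleNr opprK subrK.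
Qed.

Lemma saturated_subgroup : edge_separable ->
  exists2 L, balanced_subgroup L & forall i e, saturated L (edge i e).
Proof.
move=> sep.
have /fin_all_exists[L LP] (ie : 'I_n * bool) : exists L,
    balanced_subgroup L /\ saturated L (edge ie.1 ie.2).
  by have [L] := saturated_edge ie.1 ie.2 sep; exists L.
exists (fun x => forall ie, L ie x); first by apply: balanced_bigcap => ie; case: (LP ie).
by move=> i e x Lx; have [_] := LP (i, e); apply.
Qed.

(** Hermite normal form: the first basis vector has the least positive first
    coordinate, the second is the least positive multiple of [e2]. *)
Lemma subgroup_basis L : balanced_subgroup L -> exists s t, det s t != 0 /\
  forall x, L x <-> (`|det s t| %| cont s t x)%N.
Proof.
move=> L_bal; have [d d_gt0 Ld] := balanced_index L_bal.
have L0 : L 0 by have := Ld 0; rewrite scaler0.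
have LN x : L x -> L (- x) by rewrite -sub0r; apply: balancedB.
have LD x y : L x -> L y -> L (x + y) by rewrite -{2}[y]opprK => Lx /LN; apply: balancedB.
have LZ k x : L x -> L (k *: x).
  move=> Lx; have Lmx m : L (m%:Z *: x).
    by rewrite -natz scaler_nat; elim: m => [|m IHm]; rewrite ?mulr0n ?mulrS //; apply: LD.
  by case: k => m //; rewrite NegzE scaleNr; apply: LN.
pose P2 b := `[< (0 < b)%N /\ L (b%:Z *: e2) >].
have ex2 : exists b, P2 b by exists d; apply/asboolP.
pose P1 a := `[< (0 < a)%N /\ exists c : int, L (a%:Z *: e1 + c *: e2) >].
have ex1 : exists a, P1 a.
  by exists d; apply/asboolP; split=> //; exists 0; rewrite scale0r addr0.
have [b /asboolP[b_gt0 Lb] b_min] := ex_minnP ex2.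
have [a /asboolP[a_gt0 [c Lac]] a_min] := ex_minnP ex1.
pose s := a%:Z *: e1 + c *: e2; pose t := b%:Z *: e2.
have st : det s t = a%:Z * b%:Z by rewrite /det /s /t !mxE /=; ring.
have st_neq0 : det s t != 0 by rewrite st mulf_neq0 // -lt0n.
exists s, t; split=> // x; split=> [Lx | ]; last first.
  rewrite dvdn_cont gez0_abs ?st // -st => /andP[/dvdzP[k xs] /dvdzP[l xt]].
  suff -> : x = l *: s - k *: t by apply: balancedB => //; apply: LZ.
  apply: (scalezI st_neq0); rewrite /= det_expand xs xt scalerBr !scalerA.
  by rewrite ![_ * det s t]mulrC.
have rem_min (m : nat) (z : int) : (0 < m)%N ->
    exists2 r : nat, (r < m)%N & exists q, z = q * m%:Z + r%:Z.
  move=> m_gt0; have m_neq0 : m%:Z != 0 by rewrite -lt0n.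
  exists `|(z %% m)%Z|%N; first by rewrite -ltz_nat gez0_abs ?modz_ge0 ?ltz_pmod.
  by exists (z %/ m)%Z; rewrite gez0_abs ?modz_ge0 // -divz_eq.
have [q xq] : exists q, x 0 0 = q * a%:Z.
  have [r lt_ra [q xq]] := rem_min a (x 0 0) a_gt0; exists q; rewrite xq.
  case: (posnP r) => [->|r_gt0]; first by rewrite addr0.
  suff /a_min : P1 r by rewrite leqNgt lt_ra.
  apply/asboolP; split=> //; exists (x 0 1 - q * c).
  suff -> : r%:Z *: e1 + (x 0 1 - q * c) *: e2 = x - q *: s.
    by apply: balancedB => //; apply: LZ.
  by apply: row2_ext; rewrite !mxE /= ?xq; ring.
have [l xl] : exists l, x 0 1 - q * c = l * b%:Z.
  have [r lt_rb [l xl]] := rem_min b (x 0 1 - q * c) b_gt0; exists l; rewrite xl.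
  case: (posnP r) => [->|r_gt0]; first by rewrite addr0.
  suff /b_min : P2 r by rewrite leqNgt lt_rb.
  apply/asboolP; split=> //.
  suff -> : r%:Z *: e2 = x - q *: s - l *: t.
    by apply: (balancedB L_bal); [apply: (balancedB L_bal) => //|]; apply: LZ.
  have x1 : x 0 1 = q * c + l * b%:Z + r%:Z by rewrite -addrA -xl; ring.
  by apply: row2_ext; rewrite !mxE /= ?xq ?x1; ring.
have x1 : x 0 1 = q * c + l * b%:Z by rewrite -xl; ring.
have -> : x = q *: s + l *: t.
  by apply: row2_ext; rewrite !mxE /= ?xq; rewrite ?x1; ring.
rewrite dvdn_cont gez0_abs ?st // -st 2!(detDl (q *: s)) 2!(detZl q) 2!(detZl l) !detxx.
by rewrite !mulr0 add0r addr0 [det t s]detC mulrN rpredN !dvdz_mull.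
Qed.

(** By [det_expand], [det s t *: w] is [cont s t w] times a vector of [L].  That
    vector is on the line of [w], hence a multiple of [w] when [L] is
    saturated. *)
Lemma saturated_order L s t w : det s t != 0 -> w != 0 ->
  (forall x, L x <-> (`|det s t| %| cont s t x)%N) -> saturated L w ->
  exists2 o, `|det s t|%N = (o * cont s t w)%N &
    forall k : int, L (k *: w) <-> (o %| `|k|)%N.
Proof.
move=> st_neq0 w_neq0 LP Lw; have g_gt0 := cont_gt0 st_neq0 w_neq0.
have := dvdnn (cont s t w); rewrite {2}/cont dvdn_gcd => /andP[ws wt].
have /dvdzP[b ws_b] : (cont s t w %| det w s)%Z by rewrite dvdzE.
have /dvdzP[a wt_a] : (cont s t w %| det w t)%Z by rewrite dvdzE.
pose x := a *: s - b *: t.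
have gx : (cont s t w)%:Z *: x = det s t *: w.
  by rewrite det_expand ws_b wt_a scalerBr !scalerA ![_%:Z * _]mulrC.
have [|//|k def_x] := Lw x.
- apply/LP; rewrite dvdn_gcd /x !detBl !detZl !detxx [det t s]detC.
  by rewrite !mulr0 sub0r subr0 mulrN opprK !abszM !dvdn_mull.
- apply/eqP; have := congr1 (det^~ w) gx; rewrite !detZl detxx mulr0 => /eqP.
  by rewrite mulf_eq0 eqz_nat -leqn0 leqNgt g_gt0.
have def_st : det s t = (cont s t w)%:Z * k.
  by apply: (scalez_inj w_neq0); rewrite /= -gx def_x scalerA.
exists `|k|%N; first by rewrite def_st abszM mulnC.
by move=> j; rewrite LP contZ def_st abszM mulnC dvdn_pmul2r.
Qed.

(** In a balanced saturated lattice, [u i] and [v i] have the same order, hence by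
    [saturated_order] the same content. *)
Lemma separable_contents : edge_separable ->
  exists s t, det s t != 0 /\ forall i, cont s t (u i) = cont s t (v i).
Proof.
move=> /saturated_subgroup[L L_bal L_sat].
have [s [t [st_neq0 LP]]] := subgroup_basis L_bal.
exists s, t; split=> // i.
have [o def_o oP] := saturated_order st_neq0 (u_neq0 i) LP (L_sat i true).
have [o' def_o' oP'] := saturated_order st_neq0 (v_neq0 i) LP (L_sat i false).
have eq_o : o = o'.
  apply/eqP; rewrite eqn_dvd; apply/andP; split.
    by apply/(oP o'%:Z)/(balanced_edge L_bal)/oP'.
  by apply/(oP' o%:Z)/(balanced_edge L_bal)/oP.
have o_gt0 : (0 < o)%N by move: st_neq0; rewrite -absz_gt0 def_o; case: (o).
by apply/eqP; rewrite -(eqn_pmul2l o_gt0) -def_o eq_o -def_o'.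
Qed.

Section FromLocal.
Variables s t : nat -> 'rV[int]_2.
Hypothesis st_bal : forall p, prime p -> balanced_at u v p (s p) (t p).

(** The vectors that lie deep in the local lattices at all the small primes:
    a dilation of the local lattices keeps them balanced. *)
Definition local_subgroup (b d : nat) (x : 'rV[int]_2) : Prop :=
  forall p, prime p -> (p < b)%N -> (p ^ d %| cont (s p) (t p) x)%N.

Lemma local_subgroup_balanced b d : balanced_subgroup (local_subgroup b d).
Proof.
split=> [x y Lx Ly p p_prime lt_pb||i k].
- move: (Lx p p_prime lt_pb) (Ly p p_prime lt_pb); rewrite !dvdn_cont !detBl.
  by move=> /andP[xs xt] /andP[ys yt]; apply/andP; split; apply: rpredB.
- exists (b`! ^ d)%N => [|x p p_prime lt_pb]; first by rewrite expn_gt0 fact_gt0.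
  by rewrite contZ dvdn_mulr // dvdn_exp2r // dvdn_fact // prime_gt0 // ltnW.
- suff eq_uv p : prime p ->
      (p ^ d %| cont (s p) (t p) (k *: u i))%N = (p ^ d %| cont (s p) (t p) (k *: v i))%N.
    by split=> L_edge p p_prime; [rewrite -eq_uv | rewrite eq_uv] => //; apply: L_edge.
  move=> p_prime; rewrite !contZ; have [-> | k_neq0] := eqVneq k 0; first by rewrite !mul0n.
  have [st_neq0 cont_uv] := st_bal p_prime.
  have cont_w_gt0 w : w != 0 -> (0 < cont (s p) (t p) w)%N by apply: cont_gt0.
  by rewrite !pfactor_dvdn ?muln_gt0 ?absz_gt0 ?k_neq0 ?cont_w_gt0 //
    !lognM ?absz_gt0 ?cont_w_gt0 // cont_uv.
Qed.

(** Outside the line of an edge group a single prime is enough, a nonzero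
    determinant being divisible by few powers of 2. *)
Lemma local_separable : edge_separable.
Proof.
have ndvd_exp2 m : (0 < m)%N -> ~ (2 ^ m %| m)%N.
  by move=> m_gt0 /(dvdn_leq m_gt0); rewrite leqNgt ltn_expl.
have [st2_neq0 _] := st_bal (isT : prime 2).
split=> [x x_neq0 | i e x].
  exists (local_subgroup 3 (cont (s 2) (t 2) x)); first exact: local_subgroup_balanced.
  by move=> /(_ 2 isT isT); apply/ndvd_exp2/cont_gt0.
set w := edge i e => Nwx; have w_neq0 : w != 0 := edge_neq0 i e.
have [xw0 | xw_neq0] := eqVneq (det x w) 0; last first.
  set d := `|(det (s 2) (t 2) * det x w)%R|%N.
  exists (local_subgroup 3 d); first exact: local_subgroup_balanced.
  move=> k /(_ 2 isT isT); rewrite dvdn_cont => /andP[xs xt].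
  apply: (ndvd_exp2 d); first by rewrite absz_gt0 mulf_neq0.
  have def_d : d = `|(det (s 2) (t 2) * det (x - k *: w) w)%R|%N.
    by rewrite detBl detZl detxx mulr0 subr0.
  have : ((2 ^ d)%N%:Z %| (det (s 2) (t 2) * det (x - k *: w) w)%R)%Z.
    by rewrite det_plucker; apply: rpredB; apply: dvdz_mulr.
  by rewrite dvdzE [X in (_ %| X)%N -> _]/= -def_d.
(* An element of the line of [w] that lies in the subgroup is a multiple of [w]
   by a rational number, whose denominator divides [divisor w] and is prime to
   all the small primes. *)
pose d := (\sum_(p < (divisor w).+1) cont (s p) (t p) w)%N.
exists (local_subgroup (divisor w).+1 d); first exact: local_subgroup_balanced.
move=> k Lk; set y := x - k *: w in Lk.
have yw0 : det y w = 0 by rewrite detBl detZl detxx xw0 mulr0 subr0.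
suff [l yl] : exists l, y = l *: w.
  by apply: (Nwx (l + k)); rewrite scalerDl -yl subrK.
have [-> | y_neq0] := eqVneq y 0; first by exists 0; rewrite scale0r.
have P_gt0 := divisor_gt0 w_neq0.
have P_neq0 : (divisor w)%:Z != 0 by rewrite -lt0n.
have [m ym] := collinear yw0.
have m_neq0 : m != 0.
  by apply: contra_eq_neq (ym) => ->; rewrite scale0r scalez_eq0 negb_or y_neq0 P_neq0.
have /dvdzP[l def_m] : (divisor w %| m)%Z.
  rewrite dvdzE; apply/dvdn_partP => // p; rewrite mem_primes => /and3P[p_prime _ p_dvd].
  rewrite p_part pfactor_dvdn ?absz_gt0 //.
  have lt_pP : (p < (divisor w).+1)%N by rewrite ltnS dvdn_leq.
  have [st_neq0 _] := st_bal p_prime.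
  have := congr1 (cont (s p) (t p)) ym; rewrite !contZ => /(congr1 (logn p)).
  rewrite !lognM ?absz_gt0 ?cont_gt0 //.
  have := Lk p p_prime lt_pP; rewrite pfactor_dvdn ?cont_gt0 // => le_d.
  have le_w : (logn p (cont (s p) (t p) w) <= d)%N.
    apply: leq_trans (ltnW (ltn_logl _ (cont_gt0 st_neq0 w_neq0))) _.
    by rewrite /d (bigD1 (Ordinal lt_pP)) //= leq_addr.
  by move: le_d le_w; clear; lia.
by exists l; apply: (scalezI P_neq0); rewrite /= ym scalerA def_m mulrC.
Qed.

End FromLocal.

Lemma separable_local : edge_separable <->
  forall p, prime p -> exists s t, balanced_at u v p s t.
Proof.
split=> [/separable_contents[s [t [st_neq0 cont_st]]] p _ | bal].
  by exists s, t; split=> // i; rewrite cont_st.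
have /choice[st stP] p : exists st : 'rV[int]_2 * 'rV[int]_2,
    prime p -> balanced_at u v p st.1 st.2.
  case: (boolP (prime p)) => [/bal[s [t bal_st]] | _]; first by exists (s, t).
  by exists (0, 0).
exact: (@local_separable (fun p => (st p).1) (fun p => (st p).2)).
Qed.

End Subgroups.

(** * From finite quotients to separability *)

Section WordAction.
Variables (X : choiceType) (R : word X -> word X -> Prop).
Variables (T : Type) (act1 : X * bool -> T -> T).

Definition word_act (w : word X) (t : T) : T := foldl (fun t a => act1 a t) t w.

Hypothesis act1K : forall x b, cancel (act1 (x, b)) (act1 (x, ~~ b)).
Hypothesis act_rel : forall l r, R l r -> word_act l =1 word_act r.

Lemma word_act_cat w w' t : word_act (w ++ w') t = word_act w' (word_act w t).
Proof. exact: foldl_cat. Qed.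

(** Words act on the right, from their first letter on, and the action factors
    through the presented group. *)
Lemma word_act_eq w w' : pres_eq R w w' -> word_act w =1 word_act w'.
Proof.
elim=> {w w'} [//|w w' _ IH t|w w' w'' _ IH _ IH' t|w1 w1' w2 w2' _ IH _ IH' t|x b t|l r].
- by rewrite IH.
- by rewrite IH.
- by rewrite !word_act_cat IH IH'.
- exact: act1K.
- exact: act_rel.
Qed.

End WordAction.

Section Tubular.
Variables (n : nat) (u v : 'I_n -> 'rV[int]_2).
Hypotheses (u_neq0 : forall i, u i != 0) (v_neq0 : forall i, v i != 0).

Local Notation edge := (edge u v).
Local Notation G := (tubular_group u v).

Definition letter (i : 'I_n) (e : bool) : tub_gen n * bool := (inr i, e).

Section RationalAction.

(** The rational plane as the field of Gaussian numbers: division by a nonzero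
    vector makes any two nonzero vectors correspond under a linear map. *)
Implicit Types t w : 'rV[rat]_2.

Definition cmul t w : 'rV[rat]_2 :=
  \row_j (if j == 0 then t 0 0 * w 0 0 - t 0 1 * w 0 1 else t 0 0 * w 0 1 + t 0 1 * w 0 0).

Definition csqnorm w : rat := w 0 0 ^+ 2 + w 0 1 ^+ 2.

Definition cinv w : 'rV[rat]_2 :=
  \row_j (if j == 0 then w 0 0 / csqnorm w else - w 0 1 / csqnorm w).

Lemma csqnorm_neq0 w : w != 0 -> csqnorm w != 0.
Proof.
apply: contraNneq; rewrite /csqnorm => /eqP.
rewrite paddr_eq0 ?sqr_ge0 // !sqrf_eq0 => /andP[/eqP w0 /eqP w1].
by apply/eqP/row2_ext; rewrite !mxE.
Qed.

Definition rvec (x : 'rV[int]_2) : 'rV[rat]_2 := map_mx intr x.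

Lemma rvecD x y : rvec (x + y) = rvec x + rvec y.
Proof. exact: map_mxD. Qed.

Lemma rvecN x : rvec (- x) = - rvec x.
Proof. exact: map_mxN. Qed.

Lemma rvecZ k x : rvec (k *: x) = k%:~R *: rvec x.
Proof. exact: map_mxZ. Qed.

Lemma rvec_inj : injective rvec.
Proof.
by move=> x y /rowP xy; apply/rowP => j; have := xy j; rewrite !mxE => /intr_inj.
Qed.

Lemma rvec_neq0 x : x != 0 -> rvec x != 0.
Proof. by apply: contra_neq => x0; apply: rvec_inj; rewrite x0 /rvec map_mx0. Qed.

Definition transport i e t : 'rV[rat]_2 :=
  cmul t (cmul (cinv (rvec (edge i (~~ e)))) (rvec (edge i e))).

Lemma transportK i e : cancel (transport i e) (transport i (~~ e)).
Proof.
move=> t; rewrite /transport negbK.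
have := csqnorm_neq0 (rvec_neq0 (edge_neq0 u_neq0 v_neq0 i e)).
have := csqnorm_neq0 (rvec_neq0 (edge_neq0 u_neq0 v_neq0 i (~~ e))).
move: (rvec _) (rvec _) => w w' w_neq0 w'_neq0.
by apply: row2_ext; rewrite !mxE /=; move: w_neq0 w'_neq0; rewrite /csqnorm => *; field;
  apply/andP.
Qed.

Lemma transportD i e s t : transport i e (s + t) = transport i e s + transport i e t.
Proof. by apply: row2_ext; rewrite !mxE /=; ring. Qed.

Lemma transportZ i e (k : rat) t : transport i e (k *: t) = k *: transport i e t.
Proof. by apply: row2_ext; rewrite !mxE /=; ring. Qed.

Lemma transport_edge i e : transport i e (rvec (edge i (~~ e))) = rvec (edge i e).
Proof.
have := csqnorm_neq0 (rvec_neq0 (edge_neq0 u_neq0 v_neq0 i (~~ e))).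
rewrite /transport; move: (rvec _) (rvec _) => w w' w_neq0.
by apply: row2_ext; rewrite !mxE /=; move: w_neq0; rewrite /csqnorm => *; field.
Qed.

Definition on_line w t : Prop := exists k : int, t = k%:~R *: w.

Lemma on_lineD w t : on_line w (t + w) <-> on_line w t.
Proof.
split=> -[k kP].
  by exists (k - 1); rewrite rmorphB scalerBl scale1r -kP addrK.
by exists (k + 1); rewrite rmorphD scalerDl scale1r -kP.
Qed.

(** Translation by [w], or by [- w] when [b] is false, but only on the orbit of 0
    under translation by [w]: this commutes with that translation, and hence
    leaves the conjugation relations intact, but not with other translations. *)
Definition twist w (b : bool) t : 'rV[rat]_2 :=
  if `[< on_line w t >] then (if b then t + w else t - w) else t.

Lemma twistD w b t : twist w b (t + w) = twist w b t + w.
Proof.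
rewrite /twist (asbool_equiv_eq (on_lineD w t)).
by case: asbool => //; case: b; rewrite ?addrK ?subrK.
Qed.

Lemma twistK w b : cancel (twist w b) (twist w (~~ b)).
Proof.
move=> t; rewrite {2}/twist; case: (asboolP (on_line w t)) => [w_t|Nw_t].
  case: b; rewrite /twist.
    by rewrite (asbool_equiv_eq (on_lineD w t)) asboolT //= addrK.
  have -> : `[< on_line w (t - w) >] = true; last by rewrite subrK.
  by apply/asboolP/on_lineD; rewrite subrK.
by rewrite /twist asboolF.
Qed.

Variable twisted : option ('I_n * bool).

(** Stable letters act by linear maps, and the letter of [twisted] is moreover
    followed by a twist along its edge group, its inverse being preceded by the
    inverse twist. *)
Definition rat_act (a : tub_gen n * bool) t : 'rV[rat]_2 :=
  match a with
  | (inl x, b) => if b then t - rvec x else t + rvec x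
  | (inr i, b) =>
    if twisted == Some (i, b) then twist (rvec (edge i b)) false (transport i b t)
    else if twisted == Some (i, ~~ b) then
      transport i b (twist (rvec (edge i (~~ b))) true t)
    else transport i b t
  end.

Lemma rat_actK x b : cancel (rat_act (x, b)) (rat_act (x, ~~ b)).
Proof.
case: x => [x|i] t /=; first by case: b; rewrite /= ?addrK ?subrK.
have Nb : (Some (i, ~~ b) == Some (i, b)) = false.
  by apply/negP => /eqP[]; case: b.
have Nb' : (Some (i, b) == Some (i, ~~ b)) = false by rewrite eq_sym.
rewrite negbK; have [->|neq_b] := eqVneq twisted (Some (i, b)).
  by rewrite Nb' (@twistK _ false) transportK.
have [_ | _] := eqVneq twisted (Some (i, ~~ b)); last exact: transportK.
by rewrite transportK (@twistK _ true).
Qed.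

Lemma rat_act_edge i b t :
  rat_act (letter i b) (t + rvec (edge i (~~ b)))
  = rat_act (letter i b) t + rvec (edge i b).
Proof.
rewrite /=; case: ifP => _; first by rewrite transportD transport_edge twistD.
by case: ifP => _; rewrite ?twistD transportD transport_edge.
Qed.

Lemma rat_act_rel l r : tub_rel u v l r -> word_act rat_act l =1 word_act rat_act r.
Proof.
case=> [x y|i] t; rewrite /word_act /=; first by rewrite rvecD addrA.
have := rat_act_edge i false (rat_act (letter i true) t).
by move=> /= ->; have /= -> := @rat_actK (inr i) true t.
Qed.

End RationalAction.

Definition commutator_word i e (x y : 'rV[int]_2) : word (tub_gen n) :=
  [:: letter i e; vert n x; letter i (~~ e); vert n y;
      letter i e; vert n (- x); letter i (~~ e); vert n (- y)].

(** The linear maps alone would make the conjugate of [x] a translation.  With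
    the twist at the letter concerned, following the point that the first letter
    sends to [- x] shows that the commutator moves it: the twist applies to that
    point after it has been translated to 0, but [y] takes it off the orbit of 0
    before the twist can be undone. *)
Lemma commutator_neq1 i e x y :
  (forall k, x <> k *: edge i e) -> (forall k, y <> k *: edge i (~~ e)) ->
  ~ pres_eq (tub_rel u v) (commutator_word i e x y) [::].
Proof.
move=> Nx Ny.
move/(word_act_eq (rat_actK (Some (i, e))) (rat_act_rel (Some (i, e)))).
set w := rvec (edge i e); set w' := rvec (edge i (~~ e)).
have w_neq0 : w != 0 by apply/rvec_neq0/edge_neq0.
have Nline z : (forall k, z <> k *: edge i e) -> ~ on_line w (rvec z).
  by move=> Nz [k]; rewrite /w -rvecZ => /rvec_inj; apply: Nz.
pose h := transport i e; pose h' := transport i (~~ e).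
have hK : cancel h' h by move=> t; rewrite /h -{1}(negbK e); apply: transportK.
have h'K : cancel h h' by apply: transportK.
have h'w : h' w = w' by have := transport_edge i (~~ e); rewrite negbK.
have Nhy : ~ on_line w (h (rvec y)).
  move=> [k /(congr1 h')]; rewrite h'K => def_y; apply: (Ny k); apply: rvec_inj.
  by rewrite def_y rvecZ /h' transportZ -/h' h'w.
have Nb : (Some (i, e) == Some (i, ~~ e)) = false by apply/negP => /eqP[]; case: (e).
move=> /(_ (h' (- rvec x))).
rewrite /word_act /= eqxx Nb negbK eqxx -/w -/h -/h' hK.
have twistN t : ~ on_line w t -> twist w false t = t by move=> Nt; rewrite /twist asboolF.
have twist0 : twist w true 0 = w.
  by rewrite /twist asboolT ?add0r //; exists 0; rewrite scale0r.
rewrite (twistN (- rvec x)); last first.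
  by rewrite -rvecN; apply: Nline => k /(congr1 -%R); rewrite opprK -scaleNr; apply: Nx.
rewrite addNr twist0 [h (_ + _)]transportD.
have -> : transport i e (h' w) = w by rewrite -/h hK.
rewrite twistN; last by rewrite addrC => /on_lineD.
rewrite rvecN => /eqP; rewrite rvecN subr_eq => /eqP/(congr1 h).
rewrite hK /h transportD -/h hK /twist.
have w_double : w + w != 0.
  by rewrite -mulr2n -scaler_nat scaler_eq0 (negPf w_neq0) orbF pnatr_eq0.
case: asbool => /eqP; rewrite -subr_eq0.
  suff -> : w + h (rvec y) - rvec x + w - (- rvec x + h (rvec y)) = w + w.
    by rewrite (negPf w_double).
  by apply/rowP => j; rewrite !mxE; ring.
suff -> : w + h (rvec y) - rvec x - (- rvec x + h (rvec y)) = w by rewrite (negPf w_neq0).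
by apply/rowP => j; rewrite !mxE; ring.
Qed.

Lemma vert_neq1 x : x != 0 -> ~ pres_eq (tub_rel u v) [:: vert n x] [::].
Proof.
move=> x_neq0 /(word_act_eq (rat_actK None) (rat_act_rel None))/(_ 0).
by rewrite /word_act /= add0r; apply/eqP/rvec_neq0.
Qed.

Local Notation gen w := (pres_of (tub_rel u v) w : G).

Lemma gen_neq1 w : ~ pres_eq (tub_rel u v) w [::] -> (gen w != 1)%g.
Proof. by move=> w_neq1; apply/eqP => /pres_ofP. Qed.

Section Quotient.
Variables (Q : groupType) (f : {multiplicative G -> Q}).
Local Open Scope group_scope.

Let F (x : 'rV[int]_2) : Q := f (gen [:: vert n x]).
Let S i e : Q := f (gen [:: letter i e]).

Lemma gen_cat w w' : f (gen (w ++ w')) = f (gen w) * f (gen w').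
Proof. by rewrite -gmulfM; congr (f _); rewrite -pres_of_cat. Qed.

Lemma gen_nil : f (gen [::]) = 1.
Proof. by apply: (mulIg (f (gen [::]))); rewrite -gen_cat mul1g. Qed.

Lemma vertD x y : F (x + y)%R = F x * F y.
Proof. by rewrite -gen_cat; congr (f _); apply/esym/pres_ofP/pres_rel/tub_Z2. Qed.

Lemma vert0 : F 0%R = 1.
Proof. by apply: (mulIg (F 0%R)); rewrite -vertD addr0 mul1g. Qed.

Lemma vertN x : F (- x)%R = (F x)^-1.
Proof. by apply: (mulIg (F x)); rewrite -vertD addNr vert0 mulVg. Qed.

Lemma vertZ (k : nat) x : F (k%:Z *: x)%R = F x ^+ k.
Proof.
rewrite -natz scaler_nat; elim: k => [|k IHk]; first by rewrite mulr0n vert0.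
by rewrite mulrS expgS vertD IHk.
Qed.

Lemma letterV i e : S i (~~ e) = (S i e)^-1.
Proof.
apply: (mulgI (S i e)); rewrite mulgV -gen_cat -gen_nil; congr (f _).
exact/pres_ofP/pres_cancel.
Qed.

Lemma conj_edge i e (k : int) :
  F (k *: edge i (~~ e))%R = F (k *: edge i e)%R ^ (S i e)^-1.
Proof.
have conj_true : F (edge i false) = F (edge i true) ^ S i false.
  rewrite /conjg -(letterV i false) -!gen_cat; congr (f _).
  by apply/esym/pres_ofP/pres_rel/tub_hnn.
have conj1 : F (edge i (~~ e)) = F (edge i e) ^ (S i e)^-1.
  case: e; first by rewrite -(letterV i true).
  by rewrite conj_true conjgK.
case: k => k; first by rewrite !vertZ conj1 conjXg.
by rewrite NegzE !scaleNr !vertN !vertZ conj1 conjVg conjXg.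
Qed.

(** If [x] is congruent to an element of an edge group, its conjugate is in the
    image of the vertex group, which is abelian. *)
Lemma quotient_commutator i e x y k : F (x - k *: edge i e)%R = 1 ->
  f (gen (commutator_word i e x y)) = 1.
Proof.
move=> xk1.
have eq_x : F x = F (k *: edge i e)%R.
  by rewrite -[x in LHS](subrK (k *: edge i e)%R) vertD xk1 mul1g.
have comm_y : commute (F (k *: edge i (~~ e))%R) (F y).
  by rewrite /commute -!vertD addrC.
rewrite -[commutator_word _ _ _ _]/([:: letter i e] ++ [:: vert n x] ++ [:: letter i (~~ e)]
  ++ [:: vert n y] ++ [:: letter i e] ++ [:: vert n (- x)%R] ++ [:: letter i (~~ e)]
  ++ [:: vert n (- y)%R]).
rewrite !gen_cat -/(F x) -/(F y) -/(F (- x)%R) -/(F (- y)%R) -/(S i e) -/(S i (~~ e)).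
rewrite letterV !vertN eq_x; move: comm_y; rewrite conj_edge.
set a := F (k *: _)%R; set b := F y; set c := S i e; move=> comm_y.
transitivity (a ^ c^-1 * b * (a ^ c^-1)^-1 * b^-1).
  by rewrite /conjg !invMg !invgK !mulgA.
by rewrite comm_y mulgK mulgV.
Qed.

End Quotient.

Lemma quotient_balanced (Q : finGroupType) (f : {multiplicative G -> Q}) :
  balanced_subgroup u v (fun x => f (gen [:: vert n x]) = 1%g).
Proof.
split=> [x y Fx Fy||i k].
- by rewrite vertD vertN Fx Fy invg1 mulg1.
- exists #|[set: Q]| => [|x]; first exact: cardG_gt0.
  by rewrite vertZ expg_cardG // inE.
- have := conj_edge f i true k; rewrite /= => ->.
  by split=> [->|/eqP]; rewrite ?conj1g // conjg_eq1 => /eqP.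
Qed.

Lemma residually_finite_separable : residually_finite G -> edge_separable u v.
Proof.
move=> rfG; split=> [x x_neq0 | i e x Nx].
  have [Q [f [_ fx]]] := rfG _ (gen_neq1 (vert_neq1 x_neq0)).
  exists (fun x => f (gen [:: vert n x]) = 1%g); first exact: quotient_balanced.
  exact/eqP.
(* The vector orthogonal to an edge group lies outside it. *)
pose w := edge i (~~ e).
pose y : 'rV[int]_2 := \row_j (if j == 0 then - w 0 1 else w 0 0).
have w_neq0 : w != 0 by apply: edge_neq0.
have Ny k : y <> k *: edge i (~~ e).
  move=> yk; have : det y w = 0 by rewrite yk detZl detxx mulr0.
  rewrite /det !mxE /= => yw0; case/eqP: w_neq0.
  have : w 0 0 ^+ 2 + w 0 1 ^+ 2 == 0.
    by rewrite -oppr_eq0 -yw0 -/w; apply/eqP; ring.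
  rewrite paddr_eq0 ?sqr_ge0 // !sqrf_eq0 => /andP[/eqP w0 /eqP w1].
  by apply: row2_ext; rewrite mxE.
have [Q [f [_ fx]]] := rfG _ (gen_neq1 (commutator_neq1 Nx Ny)).
exists (fun x => f (gen [:: vert n x]) = 1%g); first exact: quotient_balanced.
by move=> k /(quotient_commutator y) f1; rewrite f1 eqxx in fx.
Qed.

End Tubular.

(** * Conjugating permutations with prescribed values *)

Local Notation order := fingraph.order.

Section Conjugation.
Variable T : finType.

Section Orbits.
Variables (f : T -> T) (o : nat).
Hypotheses (f_inj : injective f) (f_order : forall x, order f x = o).

Lemma iter_mod m x : iter (m %% o)%N f x = iter m f x.
Proof.
rewrite [in RHS](divn_eq m o) addnC iterD; congr (iter _ _ _).
by elim: (m %/ o)%N => //= q IHq; rewrite iterD -IHq -(f_order x) iter_order.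
Qed.

Lemma iter_findex_mod m x : findex f x (iter m f x) = (m %% o)%N.
Proof.
rewrite -iter_mod findex_iter // f_order ltn_mod -(f_order x).
exact: fingraph.order_gt0.
Qed.

Lemma froot_iter m x : froot f (iter m f x) = froot f x.
Proof.
apply/eqP; rewrite root_connect; last exact: fconnect_sym.
by rewrite fconnect_sym // fconnect_iter.
Qed.

(** Any representatives of distinct cycles extend to a set of representatives of
    all the cycles, whose size depends on [o] only. *)
Lemma orbit_transversal (xs : seq T) : uniq [seq froot f x | x <- xs] ->
  exists xs', let ys := xs ++ xs' in
    [/\ uniq [seq froot f x | x <- ys], (size ys * o = #|T|)%N &
      forall x, exists j m, (j < size ys)%N /\ x = iter m f (nth x ys j)].
Proof.
move=> uniq_xs; pose roots_xs := [seq froot f x | x <- xs].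
exists [seq r <- enum (froots f) | r \notin roots_xs]; set xs' := filter _ _.
have root_xs' : [seq froot f x | x <- xs'] = xs'.
  apply: map_id_in => r; rewrite mem_filter mem_enum => /andP[_]; exact: eqP.
have sym_f := fconnect_sym f_inj.
have uniq_ys : uniq [seq froot f x | x <- xs ++ xs'].
  rewrite map_cat root_xs' cat_uniq uniq_xs filter_uniq ?enum_uniq // andbT.
  by apply/hasPn => r; rewrite mem_filter => /andP[].
have mem_ys x : froot f x \in [seq froot f x | x <- xs ++ xs'].
  rewrite map_cat root_xs' mem_cat mem_filter mem_enum -/roots_xs.
  by case: (froot f x \in roots_xs) => //=; apply: roots_root.
split=> // [|x].
- rewrite -(size_map (froot f)).
  have -> : size [seq froot f x | x <- xs ++ xs'] = fcard f T.
    rewrite /n_comp_mem -(eq_card (A := froots f)); last by move=> x; rewrite !inE andbT.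
    rewrite cardE; apply/perm_size/uniq_perm; rewrite ?enum_uniq // => r.
    rewrite mem_enum; apply/mapP/idP => [[x _ ->] | r_root]; first exact: roots_root.
    by have /mapP := mem_ys r; rewrite (eqP r_root).
  apply: fcard_order_set => //.
  by apply/subsetP => x _; rewrite inE f_order.
- have /(nthP x)[j] := mem_ys x; rewrite size_map => lt_j.
  rewrite (nth_map x) // => /eqP; rewrite root_connect // => /iter_findex def_x.
  by exists j, (findex f (nth x (xs ++ xs') j) x).
Qed.

End Orbits.

(** Complete the prescribed points and their prescribed images to systems of
    representatives of the cycles; both have the same size, and matching them
    determines a conjugator. *)
Lemma conjugator (a b : T -> T) o (ps : seq (T * T)) :
  injective a -> injective b ->
  (forall x, order a x = o) -> (forall x, order b x = o) ->
  uniq [seq froot a p.1 | p <- ps] -> uniq [seq froot b p.2 | p <- ps] ->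
  exists s : T -> T, [/\ injective s, forall x, s (a x) = b (s x) &
    forall p, p \in ps -> s p.1 = p.2].
Proof.
move=> a_inj b_inj a_order b_order.
rewrite (map_comp (froot a) fst) (map_comp (froot b) snd).
move=> /(orbit_transversal a_inj a_order)[xs' /=].
set xs := _ ++ xs' => -[uniq_xs size_xs xsP].
move=> /(orbit_transversal b_inj b_order)[ys' /=].
set ys := _ ++ ys' => -[uniq_ys size_ys _].
have [x0 | no_x] := pickP T; last first.
  by exists id; split=> [//|x|[x y]]; have := no_x x.
move=> _; have o_gt0 : (0 < o)%N by rewrite -(a_order x0) fingraph.order_gt0.
have eq_size : size ys = size xs.
  by apply/eqP; rewrite -(eqn_pmul2r o_gt0) size_xs size_ys.
have nth_root z j : (j < size xs)%N ->
    froot a (nth z xs j) = nth x0 [seq froot a x | x <- xs] j.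
  by move=> lt_j; rewrite (nth_map z).
pose idx x := index (froot a x) [seq froot a x | x <- xs].
pose s x := iter (findex a (nth x0 xs (idx x)) x) b (nth x0 ys (idx x)).
have sE j m : (j < size xs)%N -> s (iter m a (nth x0 xs j)) = iter m b (nth x0 ys j).
  move=> lt_j; have idx_j : idx (iter m a (nth x0 xs j)) = j.
    by rewrite /idx froot_iter // nth_root // index_uniq ?size_map.
  by rewrite /s idx_j (iter_findex_mod a_inj a_order) (iter_mod b_inj b_order).
have xsP' x : exists j m, (j < size xs)%N /\ x = iter m a (nth x0 xs j).
  have [j [m [lt_j def_x]]] := xsP x; exists j, m; split=> //.
  by rewrite [LHS]def_x (set_nth_default x0).
exists s; split.
- move=> x x'; have [j [m [lt_j ->]]] := xsP' x; have [j' [m' [lt_j' ->]]] := xsP' x'.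
  rewrite !sE // => eq_s; have /eqP := congr1 (froot b) eq_s.
  rewrite !froot_iter // -!(nth_map _ x0 (froot b)) ?eq_size //.
  rewrite nth_uniq ?size_map ?eq_size // => /eqP eq_j; move: eq_s; rewrite eq_j.
  move/(congr1 (findex b (nth x0 ys j'))).
  rewrite !(iter_findex_mod b_inj b_order) => eq_m.
  by rewrite -(iter_mod a_inj a_order) eq_m (iter_mod a_inj a_order).
- by move=> x; have [j [m [lt_j ->]]] := xsP' x; rewrite -iterS !sE.
- move=> p p_ps; pose j := index p ps.
  have lt_j : (j < size ps)%N by rewrite index_mem.
  have xs_j : nth x0 xs j = p.1.
    by rewrite nth_cat size_map lt_j (nth_map p) // nth_index.
  have ys_j : nth x0 ys j = p.2.
    by rewrite nth_cat size_map lt_j (nth_map p) // nth_index.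
  rewrite -xs_j -ys_j; apply: (sE j 0%N).
  by rewrite size_cat size_map ltn_addr.
Qed.

End Conjugation.

Lemma order_leq (T : finType) (f g : T -> T) x y : injective g ->
  (forall k, iter k g y = y -> iter k f x = x) -> (order f x <= order g y)%N.
Proof.
move=> g_inj fix_gf; rewrite leqNgt; apply/negP => lt_gf.
have := findex_iter lt_gf; rewrite fix_gf ?iter_order // findex0 => /esym/eqP.
by rewrite -leqn0 leqNgt fingraph.order_gt0.
Qed.

(** * Finite quotients from finite actions *)

(** A finite quotient has to be onto: it is the image of the group in the
    permutations of the set acted on. *)

Section FiniteAction.
Variables (X : choiceType) (R : word X -> word X -> Prop).
Variables (T : finType) (act1 : X * bool -> T -> T).
Hypothesis act1K : forall x b, cancel (act1 (x, b)) (act1 (x, ~~ b)).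
Hypothesis act_rel : forall l r, R l r -> word_act act1 l =1 word_act act1 r.

Lemma word_act_inj w : injective (word_act act1 w).
Proof.
elim: w => [|[x b] w IHw] p q //= /IHw; exact: can_inj (act1K x b) _ _.
Qed.

Definition act_perm (g : presented R) : {perm T} :=
  perm (@word_act_inj (generic_quotient.repr g)).

Lemma act_permM : {morph act_perm : g h / (g * h)%g}.
Proof.
move=> g h; apply/permP => p; rewrite permM !permE -word_act_cat.
by apply: (word_act_eq act1K act_rel); apply: repr_pres_of.
Qed.

Lemma act_perm_pres_of w p : act_perm (pres_of R w) p = word_act act1 w p.
Proof. by rewrite permE; apply: (word_act_eq act1K act_rel); apply: repr_pres_of. Qed.

Definition act_image : {set {perm T}} := [set s | `[< exists g, act_perm g = s >]].

Lemma act_image_group : group_set act_image.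
Proof.
apply/group_setP; split=> [|s s'].
  rewrite inE; apply/asboolP; exists 1%g.
  by apply: (mulgI (act_perm 1%g)); rewrite -act_permM !mulg1.
rewrite !inE => /asboolP[g <-] /asboolP[h <-]; apply/asboolP.
by exists (g * h)%g; rewrite act_permM.
Qed.

Definition act_group : {group {perm T}} := Group act_image_group.

Definition act_quotient (g : presented R) : [subg act_group] :=
  subg act_group (act_perm g).

Lemma mem_act_perm g : act_perm g \in act_group.
Proof. by rewrite inE; apply/asboolP; exists g. Qed.

Lemma act_quotientM : {morph act_quotient : g h / (g * h)%g}.
Proof. by move=> g h; rewrite /act_quotient act_permM subgM ?mem_act_perm. Qed.

HB.instance Definition _ :=
  isMultiplicative.Build (presented R) [subg act_group] act_quotient act_quotientM.

Lemma finite_action_quotient w p : word_act act1 w p <> p ->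
  exists (Q : finGroupType) (f : {multiplicative presented R -> Q}),
    (forall q, exists h, f h = q) /\ (f (pres_of R w) != 1)%g.
Proof.
move=> w_p; exists [subg act_group], act_quotient; split.
  move=> q; have := subgP q; rewrite inE => /asboolP[g def_q]; exists g.
  by rewrite /= /act_quotient def_q sgvalK.
apply/eqP => /(congr1 val); rewrite /= subgK ?mem_act_perm // => /permP/(_ p).
by rewrite act_perm_pres_of perm1.
Qed.

End FiniteAction.

(** * Reduced words *)

Section Reduced.
Variables (n : nat) (u v : 'I_n -> 'rV[int]_2).

Local Notation edge := (edge u v).
Local Notation G := (tubular_group u v).
Local Notation gen w := (pres_of (tub_rel u v) w : G).

(** The syllable [(i, e, a)] is [letter i e] followed by [a]. *)
Definition syllable : Type := 'I_n * bool * 'rV[int]_2.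

Definition syllables (a : 'rV[int]_2) (l : seq syllable) : word (tub_gen n) :=
  vert n a :: flatten [seq [:: letter s.1.1 s.1.2; vert n s.2] | s <- l].

(** A letter and its inverse may cancel only across an element of the edge group
    that they conjugate. *)
Definition no_backtrack (s s' : syllable) : Prop :=
  s'.1 = (s.1.1, ~~ s.1.2) -> forall k, s.2 <> k *: edge s.1.1 s.1.2.

Fixpoint reduced (l : seq syllable) : Prop :=
  match l with
  | s :: ((s' :: _) as l') => no_backtrack s s' /\ reduced l'
  | _ => True
  end.

Lemma reduced_behead s l : reduced (s :: l) -> reduced l.
Proof. by case: l => // s' l []. Qed.

Lemma reduced_nth d l j : reduced l -> (j.+1 < size l)%N ->
  no_backtrack (nth d l j) (nth d l j.+1).
Proof.
elim: l j => // s [|s' l] IHl [|j] // [ss' red_l]; first by [].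
exact: IHl.
Qed.

Let idG : {multiplicative G -> G} := idfun.

Lemma gen_consE c w : gen (c :: w) = (gen [:: c] * gen w)%g.
Proof. exact: (gen_cat idG [:: c] w). Qed.

Lemma gen_vertD x y : gen [:: vert n (x + y)] = (gen [:: vert n x] * gen [:: vert n y])%g.
Proof. exact: (vertD idG). Qed.

Lemma gen_conj_edge i e k : gen [:: vert n (k *: edge i (~~ e))]
  = (gen [:: letter i e] * gen [:: vert n (k *: edge i e)] * gen [:: letter i (~~ e)])%g.
Proof.
have -> : gen [:: letter i (~~ e)] = (gen [:: letter i e])^-1%g by apply: (letterV idG).
by have := conj_edge idG i e k; rewrite /= /conjg invgK mulgA.
Qed.

(** Letters are added on the left one at a time: either the form stays reduced,
    or the first two stable letters cancel by [gen_conj_edge]. *)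
Lemma reduced_form w : exists a l, reduced l /\ gen w = gen (syllables a l).
Proof.
elim: w => [|[[x|i] e] w [a [l [red_l def_w]]]].
- by exists 0, [::]; split=> //; apply/esym/(vert0 idG).
- exists ((if e then - x else x) + a), l; split=> //.
  rewrite (gen_consE _ w) def_w /syllables !(gen_consE _ (flatten _)) gen_vertD mulgA.
  congr (_ * _ * _)%g; case: e => //.
  rewrite [RHS](vertN idG); apply: (mulgI (gen [:: vert n x])).
  rewrite mulgV -gen_consE; apply/pres_ofP/pres_cancel.
have letter_w : gen ((inr i, e) :: w) = (gen [:: letter i e] * gen (syllables a l))%g.
  by rewrite (gen_consE _ w) def_w.
have keep : reduced ((i, e, a) :: l) ->
    exists a' l', reduced l' /\ gen ((inr i, e) :: w) = gen (syllables a' l').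
  move=> red_l'; exists 0, ((i, e, a) :: l); split=> //.
  rewrite letter_w -gen_consE [RHS]gen_consE.
  by have -> : gen [:: vert n 0] = 1%g; [apply: (vert0 idG) | rewrite mul1g].
case: l => [|[[i' e'] a'] l] in red_l def_w letter_w keep *; first exact: keep.
have [no_bt | ] := pselect (no_backtrack (i, e, a) (i', e', a')); first exact: keep.
rewrite /no_backtrack /= => /not_implyP[[eq_i eq_e] /existsNP[k /contrapT def_a]].
exists (k *: edge i (~~ e) + a'), l; split; first exact: reduced_behead red_l.
set w' := flatten [seq [:: letter s.1.1 s.1.2; vert n s.2] | s <- l].
rewrite letter_w def_a /syllables /= eq_i eq_e -/w' (gen_consE _ (_ :: _ :: w')).
rewrite (gen_consE _ (_ :: w')) !(gen_consE _ w') gen_vertD gen_conj_edge.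
by rewrite !mulgA.
Qed.

End Reduced.

(** * Realizing a reduced word by a path in a finite action *)

Section Path.
Variables (n : nat) (u v : 'I_n -> 'rV[int]_2).
Local Notation edge := (edge u v).

Variables (V : finZmodType) (rho : 'rV[int]_2 -> V).
Hypothesis rhoD : forall x y, rho (x + y) = rho x + rho y.
Hypothesis rho_edge : forall i k, rho (k *: u i) = 0 <-> rho (k *: v i) = 0.

Variables (a0 : 'rV[int]_2) (l : seq (syllable n)).
Hypothesis l_reduced : reduced u v l.
Hypothesis l_separated : forall s, s \in l ->
  (forall k, s.2 <> k *: edge s.1.1 s.1.2) ->
  forall k, rho (s.2 - k *: edge s.1.1 s.1.2) <> 0.

Lemma rho0 : rho 0 = 0.
Proof. by apply: (addrI (rho 0)); rewrite -rhoD !addr0. Qed.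

Lemma rhoN x : rho (- x) = - rho x.
Proof. by apply: (addrI (rho x)); rewrite -rhoD !subrr rho0. Qed.

(** One copy of [V] for each element of the vertex group met along the word; a
    stable letter of the word leads from one copy to the next. *)
Definition place : finType := (V * 'I_(size l).+1)%type.

Definition shift (x : 'rV[int]_2) (p : place) : place := (p.1 + rho x, p.2).

Lemma shiftD x y p : shift (x + y) p = shift y (shift x p).
Proof. by rewrite /shift /= rhoD addrA. Qed.

Lemma shiftK x : cancel (shift x) (shift (- x)).
Proof. by move=> [g c]; rewrite /shift /= rhoN addrK. Qed.

Lemma shift_inj x : injective (shift x).
Proof. exact: can_inj (shiftK x). Qed.

Lemma iter_shift k x p : iter k (shift x) p = (p.1 + rho (k%:Z *: x), p.2).
Proof.
elim: k => [|k IHk] /=; first by rewrite scale0r rho0 addr0; case: p.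
by rewrite IHk /shift /= -addrA -rhoD intS scalerDl scale1r [_ + x]addrC.
Qed.

Lemma iter_shift_fix k x p : iter k (shift x) p = p <-> rho (k%:Z *: x) = 0.
Proof.
rewrite iter_shift; case: p => g c /=; split=> [[/eqP]|->]; last by rewrite addr0.
by rewrite -subr_eq0 addrAC subrr add0r => /eqP.
Qed.

Lemma order_shift i e e' p q : order (shift (edge i e)) p = order (shift (edge i e')) q.
Proof.
have fix_edge b b' k : rho (k%:Z *: edge i b) = 0 -> rho (k%:Z *: edge i b') = 0.
  by case: b; case: b' => //= /rho_edge.
apply/eqP; rewrite eqn_leq.
by apply/andP; split; apply: (order_leq (@shift_inj _)) => k /iter_shift_fix fix_k;
  apply/iter_shift_fix/(fix_edge _ _ _ fix_k).
Qed.

(** The vertex group elements of the word, the [j]-th one standing just before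
    the [j]-th stable letter, both numbered from 0. *)
Definition vertex j : 'rV[int]_2 := nth 0 (a0 :: [seq s.2 | s <- l]) j.

Definition departure j : place := (rho (vertex j), inord j).
Definition arrival j : place := (0, inord j.+1).

Section Endpoints.
Variable s0 : syllable n.
Local Notation syl j := (nth s0 l j).

(** The [j]-th stable letter must send [departure j] to [arrival j]; its inverse
    is the generator when the exponent [e] is [true].  [endpoint true j] is thus
    the point at which the value of the generator is prescribed, and
    [endpoint false j] is that value. *)
Definition endpoint b j : place := if (syl j).1.2 == b then arrival j else departure j.

(** Two prescriptions for the same generator can only collide in the copy between
    two consecutive stable letters that are inverse to each other, and there
    reducedness keeps them in distinct cycles. *)
Lemma endpoint_disconnected b i j j' : (j < j' < size l)%N ->
  (syl j).1.1 = i -> (syl j').1.1 = i ->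
  ~~ fconnect (shift (edge i b)) (endpoint b j) (endpoint b j').
Proof.
move=> /andP[lt_jj' lt_j'] syl_j syl_j'; apply/negP => /iter_findex.
move: (findex _ _ _) => m; rewrite iter_shift => eq_m.
have /(congr1 val) /= := congr1 snd eq_m; have /= := congr1 fst eq_m.
rewrite /endpoint; case: eqP => e_j; case: eqP => e_j' /=; rewrite !inordK; try lia.
move=> eq_rho eq_j; have def_j' : j' = j.+1 by lia.
have lt_j : (j.+1 < size l)%N by lia.
have no_bt := reduced_nth (d := s0) l_reduced lt_j.
apply: (l_separated (mem_nth s0 (ltnW lt_j)) _ (k := m)).
  apply: no_bt; rewrite syl_j e_j -def_j' [LHS]surjective_pairing syl_j'.
  by congr pair; move: e_j'; clear; case: (syl j').1.2 b => [] [].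
rewrite rhoD rhoN syl_j e_j; move: eq_rho; rewrite add0r => ->.
by rewrite def_j' /vertex /= (nth_map s0) ?subrr // ltnW.
Qed.

Lemma uniq_endpoints b i : uniq [seq froot (shift (edge i b)) (endpoint b j) |
  j <- [seq j <- iota 0 (size l) | (syl j).1.1 == i]].
Proof.
rewrite map_inj_in_uniq ?filter_uniq ?iota_uniq // => j j'.
rewrite !mem_filter !mem_iota /= !add0n.
move=> /andP[/eqP syl_j lt_j] /andP[/eqP syl_j' lt_j'].
have sym_shift := fconnect_sym (@shift_inj (edge i b)).
move/eqP; rewrite root_connect // => conn_jj'.
case: (ltngtP j j') => // [lt_jj' | lt_j'j].
  have := endpoint_disconnected b (i := i) (j := j) (j' := j').
  by rewrite lt_jj' lt_j' conn_jj' => /(_ isT syl_j syl_j').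
have := endpoint_disconnected b (i := i) (j := j') (j' := j).
by rewrite lt_j'j lt_j sym_shift conn_jj' => /(_ isT syl_j' syl_j).
Qed.

End Endpoints.

(** A generator has to conjugate the translations by [u i] and [v i], all of whose
    cycles have the same length as [rho_edge] gives these vectors equal orders. *)
Lemma stable_action i : exists s : place -> place,
  [/\ injective s, forall p, s (shift (u i) p) = shift (v i) (s p) &
    forall s0 j, (j < size l)%N -> (nth s0 l j).1.1 = i ->
      s (endpoint s0 true j) = endpoint s0 false j].
Proof.
pose s0 : syllable n := (i, true, 0); pose syl j := nth s0 l j.
pose ps := [seq (endpoint s0 true j, endpoint s0 false j)
  | j <- [seq j <- iota 0 (size l) | (syl j).1.1 == i]].
pose p0 : place := (0, ord0).
have [||s [s_inj s_shift s_ps]] := @conjugator place (shift (edge i true))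
    (shift (edge i false)) (order (shift (edge i true)) p0) ps
    (@shift_inj _) (@shift_inj _) (fun p => order_shift i _ _ _ _)
    (fun p => order_shift i _ _ _ _).
- by rewrite -map_comp; apply: uniq_endpoints.
- by rewrite -map_comp; apply: uniq_endpoints.
exists s; split=> // s1 j lt_j; rewrite /endpoint !(set_nth_default s0 s1 lt_j) => syl_j.
apply: (s_ps (endpoint s0 true j, endpoint s0 false j)); apply/mapP; exists j => //.
by rewrite mem_filter mem_iota /syl syl_j eqxx.
Qed.

(** The word leads from the origin of the first copy to a point of the last. *)
Lemma path_action : exists act1 : tub_gen n * bool -> place -> place,
  [/\ forall x b, cancel (act1 (x, b)) (act1 (x, ~~ b)),
      forall r r', tub_rel u v r r' -> word_act act1 r =1 word_act act1 r' &
      word_act act1 (syllables a0 l) (0, ord0) = (rho (vertex (size l)), inord (size l))].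
Proof.
have [s sP] := fin_all_exists stable_action.
have s_inj i : injective (s i) by case: (sP i).
pose t i := perm (s_inj i).
pose act1 (a : tub_gen n * bool) (p : place) : place := match a with
  | (inl x, b) => shift (if b then - x else x) p
  | (inr i, b) => if b then (t i)^-1%g p else t i p
  end.
have act1_stable s0 j : (j < size l)%N ->
    act1 (letter (nth s0 l j).1.1 (nth s0 l j).1.2) (departure j) = arrival j.
  move=> lt_j; have [_ _ /(_ s0 j lt_j erefl)] := sP (nth s0 l j).1.1.
  rewrite /endpoint /=; case: (nth s0 l j).1.2 => /= s_j; last by rewrite permE.
  by apply: (@perm_inj _ (t (nth s0 l j).1.1)); rewrite permKV permE.
exists act1; split.
- move=> [x|i] b p /=; first by case: b; rewrite /= ?shiftK // -{1}(opprK x) shiftK.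
  by case: b; rewrite /= ?permKV ?permK.
- move=> r r' [x y|i] p; rewrite /word_act /=; first by rewrite shiftD.
  have [_ s_shift _] := sP i.
  by rewrite permE s_shift -(permE (s_inj i)) -/(t i) permKV.
- suff path_to j : (j <= size l)%N ->
      word_act act1 (syllables a0 (take j l)) (0, ord0) = departure j.
    by rewrite -{1}(take_size l) path_to.
  elim: j => [_|j IHj lt_j].
    rewrite take0 /word_act /= /shift /= add0r.
    by congr pair; apply: val_inj; rewrite /= inordK.
  have s0 : syllable n by move: lt_j; case: (l).
  rewrite (take_nth s0) // /syllables map_rcons flatten_rcons -cat_cons word_act_cat.
  rewrite -/(syllables a0 (take j l)) IHj 1?ltnW // /word_act /= -/(act1 (letter _ _) _).
  have := act1_stable s0 j lt_j; rewrite /letter /= => ->.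
  by rewrite /shift /arrival /= add0r /departure /vertex /= (nth_map s0).
Qed.

End Path.

(** * From separability to finite quotients *)

Lemma intr_Zp_eq0 m (z : int) : (1 < m)%N -> (z%:~R == 0 :> 'Z_m) = (m%:Z %| z)%Z.
Proof.
move=> m_gt1; rewrite dvdzE /=.
have natr_eq0 k : (k%:R == 0 :> 'Z_m) = (m %| k)%N.
  by rewrite -val_eqE /= val_Zp_nat.
by case: z => k; rewrite ?NegzE ?rmorphN ?oppr_eq0 /= natr_eq0.
Qed.

Section Separable.
Variables (n : nat) (u v : 'I_n -> 'rV[int]_2).

Lemma subgroup_quotient L : balanced_subgroup u v L ->
  exists (V : finZmodType) (rho : 'rV[int]_2 -> V),
    (forall x y, rho (x + y) = rho x + rho y) /\ forall x, rho x = 0 <-> L x.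
Proof.
move=> L_bal; have [s [t [st_neq0 LP]]] := subgroup_basis L_bal.
(* The factor 2 makes the modulus greater than 1. *)
pose m := (2 * `|det s t|)%N.
have m_gt1 : (1 < m)%N by move: st_neq0; rewrite -absz_gt0 /m; lia.
pose rho x : 'rV['Z_m]_2 := \row_j (2 * det x (if j == 0 then s else t))%:~R.
exists 'rV['Z_m]_2, rho; split=> [x y|x].
  by apply/rowP => j; rewrite !mxE detDl mulrDr rmorphD.
have dvd2 z : ((2 * z)%:~R == 0 :> 'Z_m) = (`|det s t| %| `|z|)%N.
  by rewrite intr_Zp_eq0 // dvdzE abszM /= dvdn_pmul2l.
rewrite LP dvdn_gcd -!dvd2; split=> [/rowP rho_x|/andP[/eqP xs /eqP xt]].
  by have := (rho_x 0, rho_x 1); rewrite !mxE /= => -[-> ->]; rewrite eqxx.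
by apply: row2_ext; rewrite !mxE.
Qed.

(** A finite intersection of balanced subgroups keeps a given reduced form
    reduced; [path_action] then moves the origin, to another copy of the vertex
    group if there are stable letters, and inside the copy if there are none. *)
Lemma separable_residually_finite : edge_separable u v ->
  residually_finite (tubular_group u v).
Proof.
move=> [sep0 sep] g g_neq1.
have [a [l [red_l]]] := reduced_form u v (generic_quotient.repr g).
rewrite pres_ofK => def_g.
have sep_syl (j : option 'I_(size l)) : exists L, balanced_subgroup u v L /\
    match j with
    | None => a != 0 -> ~ L a
    | Some j => let s := tnth (in_tuple l) j in
      (forall k, s.2 <> k *: edge u v s.1.1 s.1.2) ->
      forall k, ~ L (s.2 - k *: edge u v s.1.1 s.1.2)
    end.
  case: j => [j|].
    have [Ns|edge_s] := pselect (forall k, (tnth (in_tuple l) j).2 <>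
        k *: edge u v (tnth (in_tuple l) j).1.1 (tnth (in_tuple l) j).1.2).
      by have [L L_bal LP] := sep _ _ _ Ns; exists L; split=> // _; apply: LP.
    by exists (fun=> True); split=> //; apply: balancedT.
  have [a0|/sep0[L L_bal La]] := eqVneq a 0; last by exists L.
  by exists (fun=> True); split=> //; apply: balancedT.
have [L LP] := fin_all_exists sep_syl.
have L_bal : balanced_subgroup u v (fun x => forall j, L j x).
  by apply: balanced_bigcap => j; case: (LP j).
have [V [rho [rhoD rho_eq0]]] := subgroup_quotient L_bal.
have [] := @path_action n u v V rho rhoD _ a l red_l.
- by move=> i k; rewrite !rho_eq0; apply: (balanced_edge L_bal).
- move=> s /(nthP s)[j lt_j def_s] Ns k; rewrite rho_eq0 => /(_ (Some (Ordinal lt_j))).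
  have [_] := LP (Some (Ordinal lt_j)).
  by rewrite (tnth_nth s) /= def_s => /(_ Ns); apply.
move=> act1 [act1K act_rel act_w].
have [|Q [f [f_surj f_g]]] := finite_action_quotient act1K act_rel (w := syllables a l)
  (p := (0, ord0)); last by exists Q, f; rewrite def_g.
rewrite act_w => -[rho_a /(congr1 val)]; rewrite /= inordK //.
move=> /size0nil l0; move: rho_a def_g; rewrite l0 /vertex /= => rho_a def_g.
have [a0|a_neq0] := eqVneq a 0.
  by case/eqP: g_neq1; rewrite def_g a0; apply: (vert0 idfun).
by have [_ /(_ a_neq0)] := LP None; apply; move/rho_eq0: rho_a; apply.
Qed.

End Separable.

(** * Correctness of the algorithm *)

Lemma flatten_nth4 (A : Type) (F : A -> seq nat) (s : seq A) d j r :
  (forall x, size (F x) = 4) -> (j < size s)%N -> (r < 4)%N ->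
  (4 * j + r < size (flatten [seq F x | x <- s]))%N /\
  nth 0%N (flatten [seq F x | x <- s]) (4 * j + r) = nth 0%N (F (nth d s j)) r.
Proof.
move=> size_F; elim: s j => [|x s IHs] [|j] //= lt_j lt_r; rewrite size_cat nth_cat size_F.
  by rewrite muln0 lt_r; split=> //; lia.
have [lt_js nth_js] := IHs j lt_j lt_r; have -> : (4 * j.+1 + r < 4)%N = false by lia.
have -> : (4 * j.+1 + r - 4 = 4 * j + r)%N by lia.
by rewrite nth_js; split=> //; lia.
Qed.

Section Correctness.
Variables (n : nat) (u v : 'I_n -> 'rV[int]_2).
Hypotheses (u_neq0 : forall i, u i != 0) (v_neq0 : forall i, v i != 0).

Local Notation code := (tubular_code u v).

Lemma item_size : item code 0 = n.
Proof. by rewrite item_code. Qed.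

(** [None] is the canonical basis, see [coord]. *)
Definition pair_number (o : option 'I_n) : nat := if o is Some j then j else n.

Definition pair_vec (o : option 'I_n) (b : bool) : 'rV[int]_2 :=
  match o with Some j => edge u v j b | None => if b then e1 else e2 end.

Definition offset (b : bool) : nat := if b then 0 else 2.

Lemma coord_pair o b :
  coord code (pair_number o) (offset b) = int_code (pair_vec o b 0 0) /\
  coord code (pair_number o) (offset b).+1 = int_code (pair_vec o b 0 1).
Proof.
rewrite /coord item_size; case: o => [j|] /=; last first.
  by rewrite ltnn; case: b; rewrite /= !mxE.
rewrite ltn_ord; pose F i := vec_code (u i) ++ vec_code (v i).
have item_j r : (r < 4)%N -> item code (4 * j + r).+1 = nth 0%N (F j) r.
  move=> lt_r; have lt_j : (j < size (enum 'I_n))%N by rewrite size_enum_ord.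
  have [//|lt_F nth_F] := @flatten_nth4 _ F (enum 'I_n) j j r _ lt_j lt_r.
  by rewrite item_code //= nth_F nth_ord_enum.
by case: b; rewrite !item_j.
Qed.

Lemma coord_det_pair o b o' b' :
  coord_det code (pair_number o) (offset b) (pair_number o') (offset b')
  = `|det (pair_vec o b) (pair_vec o' b')|%N.
Proof.
have [c0 c1] := coord_pair o b; have [c0' c1'] := coord_pair o' b'.
by rewrite /coord_det c0 c1 c0' c1' code_detE.
Qed.

Lemma coord_det_lt o b o' b' : (`|det (pair_vec o b) (pair_vec o' b')| < bound code)%N.
Proof.
have code_gt0 : (0 < code)%N by rewrite /tubular_code /= muln_gt0 expn_gt0.
have coord_le q c :
    (`|pair_vec q c 0%R 0%R| <= code)%N /\ (`|pair_vec q c 0%R 1%R| <= code)%N.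
  case: q => [j|]; last by case: c; rewrite /= !mxE.
  have [c0 c1] := coord_pair (Some j) c; move: c0 c1.
  rewrite /coord item_size ltn_ord => c0 c1.
  split; apply: leq_trans (int_code_bound _) _; rewrite -?c0 -?c1; exact: item_leq.
have [x0 x1] := coord_le o b; have [y0 y1] := coord_le o' b'.
rewrite /bound ltnS /det; apply: leq_trans (leqD_dist _ 0 _) _.
rewrite subr0 sub0r abszN !abszM mul2n -addnn -mulnn.
by apply: leq_add; apply: leq_mul.
Qed.

Lemma cont_lt_bound o i b : det (pair_vec o true) (pair_vec o false) != 0 ->
  (cont (pair_vec o true) (pair_vec o false) (edge u v i b) < bound code)%N.
Proof.
move=> st_neq0; have := cont_gt0 st_neq0 (edge_neq0 u_neq0 v_neq0 i b).
rewrite /cont; set s := `|_|%N; set t := `|_|%N => gcd_gt0.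
have := (coord_det_lt (Some i) b o true, coord_det_lt (Some i) b o false).
rewrite /= -/s -/t => -[lt_s lt_t]; case: (posnP s) => [s0 | s_gt0].
  by rewrite s0 gcd0n.
by apply: leq_ltn_trans lt_s; apply: dvdn_leq => //; apply: dvdn_gcdl.
Qed.

Lemma balancesP o p : prime p -> reflect
  (balanced_at u v p (pair_vec o true) (pair_vec o false))
  (balances (pair_number o) p code).
Proof.
move=> p_prime; rewrite /balances item_size.
have := coord_det_pair o true o false; rewrite /offset => ->; rewrite absz_eq0.
have [st_eq0 | st_neq0] := eqVneq (det (pair_vec o true) (pair_vec o false)) 0.
  by right=> -[]; rewrite st_eq0 eqxx.
have same_powerE (i : 'I_n) e : same_power e i (pair_number o) p code
    = ((e <= logn p (cont (pair_vec o true) (pair_vec o false) (u i)))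
        == (e <= logn p (cont (pair_vec o true) (pair_vec o false) (v i))))%N.
  rewrite /same_power -2?pfactor_dvdn ?cont_gt0 // !dvdn_gcd.
  have := (coord_det_pair (Some i) true o true, coord_det_pair (Some i) true o false,
    coord_det_pair (Some i) false o true, coord_det_pair (Some i) false o false).
  by rewrite /= => -[[[-> ->] ->] ->].
have logn_lt i b :
    (logn p (cont (pair_vec o true) (pair_vec o false) (edge u v i b)) < bound code)%N.
  apply: leq_ltn_trans (cont_lt_bound i b st_neq0).
  by apply/ltnW/ltn_logl/cont_gt0 => //; apply: edge_neq0.
apply: (iffP allP) => [bal | [_ bal] i].
  split=> // i; apply/eqP; rewrite eqn_leq.
  have /allP bal_i :
      all (fun e => same_power e i (pair_number o) p code) (iota 0 (bound code)).
    by apply: bal; rewrite mem_iota add0n ltn_ord.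
  have le_logn b b' : b' = ~~ b ->
      (logn p (cont (pair_vec o true) (pair_vec o false) (edge u v i b))
        <= logn p (cont (pair_vec o true) (pair_vec o false) (edge u v i b')))%N.
    have := bal_i (logn p (cont (pair_vec o true) (pair_vec o false) (edge u v i b))).
    rewrite mem_iota add0n logn_lt same_powerE => /(_ isT).
    by case: b => /eqP eq_le -> /=; [rewrite -eq_le | rewrite eq_le]; apply: leqnn.
  by rewrite (le_logn true false) // (le_logn false true).
rewrite mem_iota add0n => /andP[_ lt_i]; apply/allP => e _.
by rewrite -[i]/(val (Ordinal lt_i)) same_powerE bal eqxx.
Qed.

(** At the primes beyond [bound code] no content is divisible by [p], and the
    canonical basis is balanced. *)
Lemma rf_testP : reflect (residually_finite (tubular_group u v)) (rf_test code).
Proof.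
have separableP : residually_finite (tubular_group u v) <->
    forall p, prime p -> exists o, balanced_at u v p (pair_vec o true) (pair_vec o false).
  split=> [rfG p p_prime | bal].
    have /separable_local := residually_finite_separable u_neq0 v_neq0 rfG.
    case/(_ u_neq0 v_neq0 p p_prime) => s [t].
    case/(balanced_finite u_neq0 v_neq0 p_prime) => [bal|[j bal]]; first by exists None.
    by exists (Some j).
  apply: separable_residually_finite; apply/separable_local => // p.
  by case/bal=> o bal_o; exists (pair_vec o true), (pair_vec o false).
have small p : prime p -> (p >= bound code)%N -> balances n p code.
  move=> p_prime le_p; have e_neq0 : det e1 e2 != 0 by rewrite det_e.
  apply/(balancesP None p_prime); split=> // i.
  have val_w b : logn p (cont e1 e2 (edge u v i b)) = 0%N.
    have cont_lt : (cont e1 e2 (edge u v i b) < p)%N.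
      by apply: leq_trans (@cont_lt_bound None i b e_neq0) le_p.
    rewrite lognE; case: ifP => // /and3P[_ cont_gt0 /(dvdn_leq cont_gt0)].
    by rewrite leqNgt cont_lt.
  by rewrite (val_w true) (val_w false).
apply: (iffP allP) => [test | /separableP bal p].
  apply/separableP => p p_prime.
  have [lt_p | ] := ltnP p (bound code); last first.
    by move=> /(small p p_prime)/(balancesP None p_prime); exists None.
  have := test p; rewrite mem_iota add0n lt_p => /(_ isT)/orP[|/hasP[j]].
    by rewrite p_prime.
  rewrite item_size mem_iota => /andP[_].
  rewrite add0n ltnS leq_eqVlt => /orP[/eqP->|lt_j] bal.
    by exists None; apply/balancesP.
  by exists (Some (Ordinal lt_j)); apply/balancesP.
move=> _; apply/orP; case: (boolP (prime p)) => [p_prime|]; [right | by left].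
have [o /(balancesP o p_prime) bal_o] := bal p p_prime.
apply/hasP; exists (pair_number o) => //; rewrite item_size mem_iota add0n ltnS.
by case: o {bal_o} => [j|] /=; rewrite ?leqnn // ltnW.
Qed.

End Correctness.

Theorem theorem1p2 :
  exists p : recf 1,
    forall (n : nat) (u v : 'I_n -> 'rV[int]_2),
      (forall i : 'I_n, u i <> 0%R /\ v i <> 0%R) ->
      exists b : bool,
        eval p [tuple tubular_code u v] (nat_of_bool b) /\
        (b = true <-> residually_finite (tubular_group u v)).
Proof.
have [p pP] := decidable_rf_test; exists p => n u v uv_neq0.
exists (rf_test (tubular_code u v)); split; first exact: pP [tuple _].
have u_neq0 i : u i != 0 by apply/eqP; case: (uv_neq0 i).
have v_neq0 i : v i != 0 by apply/eqP; case: (uv_neq0 i).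
by split=> /(rf_testP u_neq0 v_neq0).
Qed.
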